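(* Let $X$ and $Z$ be any two nondegenerate observables on a $d$-dimensional Hilbert space $\mathcal H_A$, with orthonormal eigenbases $\{|\varphi_x\rangle\}_{x\in\mathsf X}$ and $\{|\theta_z\rangle\}_{z\in\mathsf Z}$ respectively. Let $\mathcal E:L^\infty(\mathsf Y)\otimes\mathcal B(\mathcal H_B)\to\mathcal B(\mathcal H_A)$ be any quantum instrument with classical output in a finite set $\mathsf Y$ and finite-dimensional quantum output space $\mathcal H_B$. Then $$\sqrt{2\varepsilon_X(\mathcal E)}+\eta_Z(\mathcal E)\;\ge\; c_P(X,Z)\qquad\text{and}\qquad \sqrt{2\varepsilon_X(\mathcal E)}+\widehat\eta_Z(\mathcal E)\;\ge\;\widehat c_P(X,Z),$$ where $\varepsilon_X$ is the measurement error, $\eta_Z,\widehat\eta_Z$ the two preparation disturbances, and $c_P,\widehat c_P$ the complementarity measures defined in the context.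
   Context: Heisenberg picture: a quantum channel is a completely positive unital linear map from the algebra of observables of the output system to that of the input system. A quantum system with Hilbert space $\mathcal H$ has algebra $\mathcal B(\mathcal H)$; a classical system with values in a finite set $\mathsf Y$ has algebra $L^\infty(\mathsf Y)$ (functions on $\mathsf Y$); hybrid systems have the tensor product algebra. A quantum instrument is a channel $\mathcal E:L^\infty(\mathsf Y)\otimes\mathcal B(\mathcal H_B)\to\mathcal B(\mathcal H_A)$. Juxtaposition of channels is composition of maps: $(\mathcal E\mathcal F)(a)=\mathcal E(\mathcal F(a))$. Distinguishability: for channels $\mathcal E_1,\mathcal E_2$ between the same algebras, $\delta(\mathcal E_1,\mathcal E_2)=\tfrac12\|\mathcal E_1-\mathcal E_2\|_{\rm cb}$, where $\|T\|_{\rm cb}=\sup_{n\in\mathbb N}\|\mathrm{id}_n\otimes T\|_\infty$ and $\|\cdot\|_\infty$ is the norm of a linear map with respect to operator norms. Ideal devices: the measurement $\mathcal Q_X:L^\infty(\mathsf X)\to\mathcal B(\mathcal H_A)$, $\mathcal Q_X(f)=\sum_x f(x)|\varphi_x\rangle\langle\varphi_x|$, and the preparation $\mathcal P_Z:\mathcal B(\mathcal H_A)\to L^\infty(\mathsf Z)$, $(\mathcal P_Z(a))(z)=\langle\theta_z|a|\theta_z\rangle$. Measurement error: $\varepsilon_X(\mathcal E)=\inf_{\mathcal R}\delta(\mathcal Q_X,\mathcal E_{\mathcal R})$, where the infimum is over channels $\mathcal R:L^\infty(\mathsf X)\to L^\infty(\mathsf Y)$ and $\mathcal E_{\mathcal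 R}(f)=\mathcal E(\mathcal R(f)\otimes\mathbb 1_B)$. Preparation disturbance: $\eta_Z(\mathcal E)=\inf_{\mathcal R}\delta(\mathcal P_Z,\mathcal P_Z\mathcal E\mathcal R)$, where the infimum is over channels $\mathcal R:\mathcal B(\mathcal H_A)\to L^\infty(\mathsf Y)\otimes\mathcal B(\mathcal H_B)$. Demerit preparation disturbance: $\widehat\eta_Z(\mathcal E)=\tfrac{d-1}{d}-\inf_{\mathcal C}\delta(\mathcal C,\mathcal P_Z\mathcal E)$, where the infimum is over constant channels $\mathcal C:L^\infty(\mathsf Y)\otimes\mathcal B(\mathcal H_B)\to L^\infty(\mathsf Z)$, i.e. channels of the form $\mathcal C(a)=\sigma(a)\,\mathbb 1$ for a fixed state $\sigma$ on the output algebra. Complementarity measures (regarding $\mathcal Q_X$ as an instrument having only the classical output $\mathsf X$): $c_P(X,Z)=\eta_Z(\mathcal Q_X)=\inf_{\mathcal R}\delta(\mathcal P_Z,\mathcal P_Z\mathcal Q_X\mathcal R)$ over channels $\mathcal R:\mathcal B(\mathcal H_A)\to L^\infty(\mathsf X)$, and $\widehat c_P(X,Z)=\widehat\eta_Z(\mathcal Q_X)=\tfrac{d-1}{d}-\inf_{\mathcal C}\delta(\mathcal C,\mathcal P_Z\mathcal Q_X)$ over constant channels $\mathcal C:L^\infty(\mathsf X)\to L^\infty(\mathsf Z)$. *)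

(* Defs.v *)
From mathcomp Require Export all_boot all_order all_algebra.
From mathcomp Require Export spectral complex.
From mathcomp Require Export boolp classical_sets reals.

Set Implicit Arguments.
Unset Strict Implicit.
Unset Printing Implicit Defensive.

Import Order.TTheory GRing.Theory Num.Theory.
Local Open Scope ring_scope.
Local Open Scope complex_scope.
Local Open Scope sesquilinear_scope.
Local Open Scope classical_set_scope.

(* Kets are column vectors; the inner product is antilinear in its first
   argument. *)
Definition braket (R : realType) n (u v : 'cV[R[i]]_n) : R[i] :=
  (u^t* *m v) 0 0.

Definition vnorm (R : realType) n (v : 'cV[R[i]]_n) : R :=
  Num.sqrt (complex.Re (braket v v)).

Definition opnorm (R : realType) m n (A : 'M[R[i]]_(m, n)) : R :=
  sup [set vnorm (A *m v) | v in [set v | vnorm v <= 1]].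

(* The order of R[i] makes 0 <= z mean that z is real and nonnegative. *)
Definition psdmx (R : realType) n (A : 'M[R[i]]_n) : Prop :=
  forall v : 'cV[R[i]]_n, 0 <= braket v (A *m v).

(* A system has a finite set Y of classical values and a Hilbert space C^b.
   Its algebra of observables L^oo(Y) (x) B(C^b) is realized as the algebra of
   functions from Y to the b x b matrices.  The purely quantum and the purely
   classical systems are the cases where Y is a point and where b = 1, so that
   B(C^n) (x) L^oo(point) and L^oo(Y) (x) B(C) stand for B(C^n) and L^oo(Y). *)
Record system := System { values : finType; hdim : nat }.

Definition quantum (n : nat) : system := System unit n.
Definition classical (Y : finType) : system := System Y 1.
Definition hybrid (Y : finType) (b : nat) : system := System Y b.

Definition obs (R : realType) (S : system) :=
  {ffun values S -> 'M[R[i]]_(hdim S)}.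

Definition obs1 (R : realType) (S : system) : obs R S := [ffun=> 1%:M].

Definition obs_pos (R : realType) S (a : obs R S) : Prop :=
  forall y, psdmx (a y).

(* M_n (x) A is identified with the n x n matrices with entries in A, so that
   id_n (x) T is [map_mx T].  For A = L^oo(Y) (x) B(C^b), the component at y of
   an element of M_n (x) A is the following operator on C^n (x) C^b. *)
Definition amp_at (R : realType) S n (a : 'M[obs R S]_n) (y : values S) :
    'M[R[i]]_(\sum_(i < n) hdim S) :=
  mxblock (fun i j : 'I_n => a i j y).

Definition amp_pos (R : realType) S n (a : 'M[obs R S]_n) : Prop :=
  forall y, psdmx (amp_at a y).

Definition amp_norm (R : realType) S n (a : 'M[obs R S]_n) : R :=
  \big[Num.max/0]_(y : values S) opnorm (amp_at a y).

Definition amplification_norm (R : realType) S S' (T : obs R S -> obs R S')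
    (n : nat) : R :=
  sup [set amp_norm (map_mx T a) | a in [set a : 'M_n | amp_norm a <= 1]].

(* All suprema in this file are over nonempty sets, and they are finite because
   all the spaces involved are finite-dimensional (T being linear). *)
Definition cb_norm (R : realType) S S' (T : obs R S -> obs R S') : R :=
  sup (range (amplification_norm T)).

Definition distinguishability (R : realType) S S'
    (E1 E2 : obs R S -> obs R S') : R :=
  2^-1 * cb_norm (fun a => E1 a - E2 a).

Definition completely_positive (R : realType) S S'
    (T : obs R S -> obs R S') : Prop :=
  forall (n : nat) (a : 'M[obs R S]_n), amp_pos a -> amp_pos (map_mx T a).

Definition channel (R : realType) S S' (T : obs R S -> obs R S') : Prop :=
  [/\ linear T, T (obs1 R S) = obs1 R S' & completely_positive T].

Definition state (R : realType) S (s : obs R S -> R[i]) : Prop :=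
  [/\ scalar s, s (obs1 R S) = 1 & forall a, obs_pos a -> 0 <= s a].

Definition constant_channel (R : realType) S S'
    (C : obs R S -> obs R S') : Prop :=
  channel C /\ exists2 s, state s & forall a, C a = s a *: obs1 R S'.

(* [eigenspace] is about row vectors, hence the transposition. *)
Definition nondegenerate_observable (R : realType) d (A : 'M[R[i]]_d) : Prop :=
  A \is hermsymmx /\
  forall l, eigenvalue A^T l -> \rank (eigenspace A^T l) = 1%N.

Definition orthonormal_basis (R : realType) d (X : finType)
    (phi : X -> 'cV[R[i]]_d) : Prop :=
  (forall x x', braket (phi x) (phi x') = (x == x')%:R) /\
  (forall v, exists c : X -> R[i], v = \sum_x c x *: phi x).

Definition orthonormal_eigenbasis (R : realType) d (A : 'M[R[i]]_d)
    (X : finType) (phi : X -> 'cV[R[i]]_d) : Prop :=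
  orthonormal_basis phi /\
  forall x, exists l : R[i], A *m phi x = l *: phi x.

Definition instrument (R : realType) (Y : finType) b d
    (E : obs R (hybrid Y b) -> obs R (quantum d)) : Prop := channel E.

Definition ideal_measurement (R : realType) d (X : finType)
    (phi : X -> 'cV[R[i]]_d) :
    obs R (classical X) -> obs R (quantum d) :=
  fun f => [ffun=> \sum_x f x 0 0 *: (phi x *m (phi x)^t*)].

Definition ideal_preparation (R : realType) d (Z : finType)
    (theta : Z -> 'cV[R[i]]_d) :
    obs R (quantum d) -> obs R (classical Z) :=
  fun a => [ffun z => (braket (theta z) (a tt *m theta z))%:M].

(* f |-> f (x) 1 from L^oo(Y) to L^oo(Y) (x) B(C^b) *)
Definition tensor1 (R : realType) (Y : finType) (b : nat)
    (f : obs R (classical Y)) : obs R (hybrid Y b) :=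
  [ffun y => (f y 0 0)%:M].

Definition measurement_error (R : realType) d b (X Y : finType)
    (phi : X -> 'cV[R[i]]_d)
    (E : obs R (hybrid Y b) -> obs R (quantum d)) : R :=
  inf [set distinguishability (ideal_measurement phi)
             (fun f => E (tensor1 b (r f)))
      | r in [set r : obs R (classical X) -> obs R (classical Y) | channel r]].

Definition preparation_disturbance (R : realType) d b (Z Y : finType)
    (theta : Z -> 'cV[R[i]]_d)
    (E : obs R (hybrid Y b) -> obs R (quantum d)) : R :=
  inf [set distinguishability (ideal_preparation theta)
             (ideal_preparation theta \o E \o r)
      | r in [set r : obs R (quantum d) -> obs R (hybrid Y b) | channel r]].

Definition demerit_disturbance (R : realType) d b (Z Y : finType)
    (theta : Z -> 'cV[R[i]]_d)
    (E : obs R (hybrid Y b) -> obs R (quantum d)) : R :=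
  (d%:R - 1) / d%:R -
  inf [set distinguishability C (ideal_preparation theta \o E)
      | C in [set C : obs R (hybrid Y b) -> obs R (classical Z)
             | constant_channel C]].

(* [classical X] is convertible to [hybrid X 1]: the ideal measurement is seen
   as an instrument with only a classical output. *)
Definition complementarity (R : realType) d (X Z : finType)
    (phi : X -> 'cV[R[i]]_d) (theta : Z -> 'cV[R[i]]_d) : R :=
  preparation_disturbance (b := 1) (Y := X) theta (ideal_measurement phi).

Definition demerit_complementarity (R : realType) d (X Z : finType)
    (phi : X -> 'cV[R[i]]_d) (theta : Z -> 'cV[R[i]]_d) : R :=
  demerit_disturbance (b := 1) (Y := X) theta (ideal_measurement phi).

(* Main.v *)
Require Import Defs.
From mathcomp Require Import ring lra.

(** Let e be the error of the readout of E followed by a post-processing r.  It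
    suffices to find a channel M such that E and Q_X M are at distance at most
    sqrt (2 e), up to an arbitrarily small constant: both inequalities then
    follow from the triangle inequality, because composing with channels does
    not increase the distance.

    Splitting E along the outcome x of the post-processed readout gives Kraus
    operators V_x of E with effects V_x^* V_x = Lam_x close to |phi_x><phi_x|.
    The isometries of the form psi |-> sum_x |x> <phi_x|psi> u_x dilate the maps
    Q_X M, and the best choice of the vectors u_x is given by a minimax argument:
    take u_x proportional to V_x rho phi_x, where rho nearly minimises the fidelity
    sum_x |V_x rho phi_x|.  This minimum is at least 1 - e, which bounds the
    squared distance of the dilations of E and Q_X M by 2 e. *)

Set Implicit Arguments.
Unset Strict Implicit.
Unset Printing Implicit Defensive.

Import Order.TTheory GRing.Theory Num.Theory.
Local Open Scope ring_scope.
Local Open Scope complex_scope.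
Local Open Scope sesquilinear_scope.
Local Open Scope classical_set_scope.

(** For a single state rho the best u_x are the normalised V_x rho phi_x, but the cb norm is a
    supremum over all input states, so one family must serve every rho'. Convexity provides it: the
    fidelity is convex in rho, and at a minimiser its derivative towards any rho' is nonnegative,
    which says exactly that the overlap sum_x Re <u_x, V_x rho' phi_x> is at least the minimum. The
    norm is not differentiable where V_x rho phi_x = 0; hence it is smoothed by a constant k, and
    the loss is of order k. The constant comes from isometries V and W: |V psi - W psi|^2 = 2 - 2 Re
    <V psi, W psi> for unit psi, and V^* a V - W^* a W has norm at most 2 |V - W| |a|. The factor
    1/2 in the distinguishability removes this last 2. *)

Section HilbertSchmidt.
Variable R : realType.
Local Notation C := R[i].
Local Notation Re := complex.Re.

(** * Real parts, adjoints and the Hilbert-Schmidt inner product *)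

Lemma ReD (x y : C) : Re (x + y) = Re x + Re y.
Proof. by case: x; case: y. Qed.

Lemma ReN (x : C) : Re (- x) = - Re x.
Proof. by case: x. Qed.

Lemma Re_sum (I : Type) (s : seq I) (P : pred I) (F : I -> C) :
  Re (\sum_(i <- s | P i) F i) = \sum_(i <- s | P i) Re (F i).
Proof. exact: (big_morph (@complex.Re R) ReD). Qed.

Lemma Re_realM (t : R) (x : C) : Re (t%:C * x) = t * Re x.
Proof. by case: x => a c /=; rewrite mul0r subr0. Qed.

Lemma Re_conj (x : C) : Re (Num.conj x) = Re x.
Proof. by case: x. Qed.

Lemma conj_real (t : R) : Num.conj t%:C = t%:C.
Proof. by apply/eqP; rewrite eq_complex /= oppr0 !eqxx. Qed.

Lemma Re_ge0 (x : C) : 0 <= x -> 0 <= Re x.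
Proof. by rewrite lecE => /andP[]. Qed.

Lemma ReK (x : C) : 0 <= x -> (Re x)%:C = x.
Proof. by case: x => a c; rewrite lecE /= => /andP[/eqP ->]. Qed.

Definition hs m n (U V : 'M[C]_(m, n)) : C := \tr (U^t* *m V).
Definition rip m n (U V : 'M[C]_(m, n)) : R := Re (hs U V).
Definition nsq m n (V : 'M[C]_(m, n)) : R := rip V V.

Lemma adjM m n p (A : 'M[C]_(m, n)) (B : 'M[C]_(n, p)) :
  (A *m B)^t* = B^t* *m A^t*.
Proof. by rewrite trmx_mul map_mxM. Qed.

Lemma adjD m n (A B : 'M[C]_(m, n)) : (A + B)^t* = A^t* + B^t*.
Proof. by apply/matrixP => i j; rewrite !mxE rmorphD. Qed.

Lemma adjN m n (A : 'M[C]_(m, n)) : (- A)^t* = - A^t*.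
Proof. by apply/matrixP => i j; rewrite !mxE rmorphN. Qed.

Lemma adjZ m n a (A : 'M[C]_(m, n)) : (a *: A)^t* = Num.conj a *: A^t*.
Proof. by apply/matrixP => i j; rewrite !mxE rmorphM. Qed.

Lemma adj1 n : (1%:M : 'M[C]_n)^t* = 1%:M.
Proof. by rewrite trmx1 map_mx1. Qed.

Lemma hsE m n (U V : 'M[C]_(m, n)) :
  hs U V = \sum_i \sum_j Num.conj (U i j) * V i j.
Proof.
rewrite /hs /mxtrace exchange_big; apply: eq_bigr => j _ /=.
by rewrite mxE; apply: eq_bigr => i _; rewrite !mxE.
Qed.

Lemma hs_braket n (u v : 'cV[C]_n) : hs u v = braket u v.
Proof. by rewrite /hs /mxtrace big_ord1. Qed.

Lemma hs_col m n (U V : 'M[C]_(m, n)) :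
  hs U V = \sum_i braket (col i U) (col i V).
Proof.
rewrite hsE exchange_big; apply: eq_bigr => i _ /=.
by rewrite -hs_braket hsE; apply: eq_bigr => k _; rewrite big_ord1 !mxE.
Qed.

Lemma hsDl m n (U V W : 'M[C]_(m, n)) : hs (U + V) W = hs U W + hs V W.
Proof. by rewrite /hs adjD mulmxDl raddfD. Qed.

Lemma hsDr m n (U V W : 'M[C]_(m, n)) : hs W (U + V) = hs W U + hs W V.
Proof. by rewrite /hs mulmxDr raddfD. Qed.

Lemma hsNl m n (U W : 'M[C]_(m, n)) : hs (- U) W = - hs U W.
Proof. by rewrite /hs adjN mulNmx raddfN. Qed.

Lemma hsNr m n (U W : 'M[C]_(m, n)) : hs W (- U) = - hs W U.
Proof. by rewrite /hs mulmxN raddfN. Qed.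

Lemma hsZl m n a (U W : 'M[C]_(m, n)) : hs (a *: U) W = Num.conj a * hs U W.
Proof. by rewrite /hs adjZ -scalemxAl mxtraceZ. Qed.

Lemma hsZr m n a (U W : 'M[C]_(m, n)) : hs W (a *: U) = a * hs W U.
Proof. by rewrite /hs -scalemxAr mxtraceZ. Qed.

Lemma hs_sumr m n (I : Type) (s : seq I) (P : pred I) (F : I -> 'M[C]_(m, n))
    (W : 'M[C]_(m, n)) :
  hs W (\sum_(i <- s | P i) F i) = \sum_(i <- s | P i) hs W (F i).
Proof. by rewrite /hs mulmx_sumr raddf_sum. Qed.

Lemma hs_adjr m n p (A : 'M[C]_(m, n)) (U : 'M[C]_(m, p)) (V : 'M[C]_(n, p)) :
  hs U (A *m V) = hs (A^t* *m U) V.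
Proof. by rewrite /hs adjM trmxCK mulmxA. Qed.

Lemma hs_adjl m n p (A : 'M[C]_(m, n)) (U : 'M[C]_(m, p)) (V : 'M[C]_(n, p)) :
  hs (A *m V) U = hs V (A^t* *m U).
Proof. by rewrite hs_adjr trmxCK. Qed.

Lemma hs_adj m n (U V : 'M[C]_(m, n)) : hs (U^t*) (V^t*) = hs V U.
Proof. by rewrite /hs trmxCK mxtrace_mulC. Qed.

Lemma hs_conj m n (U V : 'M[C]_(m, n)) : Num.conj (hs U V) = hs V U.
Proof.
rewrite !hsE rmorph_sum; apply: eq_bigr => i _.
rewrite rmorph_sum; apply: eq_bigr => j _.
rewrite rmorphM /= mulrC; congr (_ * _); exact: (@conjCK C).
Qed.

Lemma hs_ge0 m n (V : 'M[C]_(m, n)) : 0 <= hs V V.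
Proof.
rewrite hsE; apply: sumr_ge0 => i _; apply: sumr_ge0 => j _.
by rewrite mulrC mul_conjC_ge0.
Qed.

Lemma rip_mulr m n p (V : 'M[C]_(m, n)) (t : 'M_(n, p)) (W : 'M_(m, p)) :
  rip (V *m t) W = rip V (W *m t^t*).
Proof. by rewrite /rip /hs adjM -mulmxA mxtrace_mulC mulmxA. Qed.

Lemma ripC m n (U V : 'M[C]_(m, n)) : rip U V = rip V U.
Proof. by rewrite /rip -hs_conj Re_conj. Qed.

Lemma ripDl m n (U V W : 'M[C]_(m, n)) : rip (U + V) W = rip U W + rip V W.
Proof. by rewrite /rip hsDl ReD. Qed.

Lemma ripDr m n (U V W : 'M[C]_(m, n)) : rip W (U + V) = rip W U + rip W V.
Proof. by rewrite /rip hsDr ReD. Qed.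

Lemma ripNl m n (U W : 'M[C]_(m, n)) : rip (- U) W = - rip U W.
Proof. by rewrite /rip hsNl ReN. Qed.

Lemma ripNr m n (U W : 'M[C]_(m, n)) : rip W (- U) = - rip W U.
Proof. by rewrite /rip hsNr ReN. Qed.

Lemma ripZl m n (t : R) (U W : 'M[C]_(m, n)) :
  rip (t%:C *: U) W = t * rip U W.
Proof. by rewrite /rip hsZl conj_real Re_realM. Qed.

Lemma ripZr m n (t : R) (U W : 'M[C]_(m, n)) :
  rip W (t%:C *: U) = t * rip W U.
Proof. by rewrite /rip hsZr Re_realM. Qed.

Lemma nsq_ge0 m n (V : 'M[C]_(m, n)) : 0 <= nsq V.
Proof. exact/Re_ge0/hs_ge0. Qed.

Lemma hs_nsq m n (V : 'M[C]_(m, n)) : hs V V = (nsq V)%:C.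
Proof. by rewrite /nsq /rip ReK ?hs_ge0. Qed.

Lemma nsq0 m n : nsq (0 : 'M[C]_(m, n)) = 0.
Proof. by rewrite /nsq /rip /hs mulmx0 raddf0. Qed.

Lemma nsq_eq0 m n (V : 'M[C]_(m, n)) : nsq V = 0 -> V = 0.
Proof.
move=> V0; have: hs V V = 0 by rewrite hs_nsq V0.
have pos (i : 'I_m) (j : 'I_n) : 0 <= Num.conj (V i j) * V i j.
  by rewrite mulrC mul_conjC_ge0.
rewrite hsE => /eqP; rewrite psumr_eq0 => [|i _]; last exact: sumr_ge0.
move=> /allP V0i; apply/matrixP => i j; rewrite mxE.
have := V0i i (mem_index_enum _).
rewrite psumr_eq0 // => /allP /(_ j (mem_index_enum _)).
by rewrite mulrC mul_conjC_eq0 => /eqP.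
Qed.

Lemma nsqD m n (U V : 'M[C]_(m, n)) :
  nsq (U + V) = nsq U + nsq V + 2 * rip U V.
Proof. by rewrite /nsq ripDl !ripDr (ripC V U); ring. Qed.

Lemma nsqN m n (V : 'M[C]_(m, n)) : nsq (- V) = nsq V.
Proof. by rewrite /nsq ripNl ripNr opprK. Qed.

Lemma nsqB m n (U V : 'M[C]_(m, n)) :
  nsq (U - V) = nsq U + nsq V - 2 * rip U V.
Proof. by rewrite nsqD nsqN ripNr; ring. Qed.

Lemma nsqZ m n (t : R) (V : 'M[C]_(m, n)) : nsq (t%:C *: V) = t ^+ 2 * nsq V.
Proof. by rewrite /nsq ripZl ripZr mulrA. Qed.

Lemma nsq_adj m n (V : 'M[C]_(m, n)) : nsq (V^t*) = nsq V.
Proof. by rewrite /nsq /rip hs_adj. Qed.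

Lemma nsq_mulmx m n p (A : 'M[C]_(m, n)) (U : 'M[C]_(n, p)) :
  nsq (A *m U) = rip U (A^t* *m A *m U).
Proof. by rewrite /nsq /rip hs_adjl mulmxA. Qed.

(* Cauchy-Schwarz: expand the norm of [|w|^2 U - w (w^* U)]. *)
Lemma nsq_braket_le n p (w : 'cV[C]_n) (U : 'M[C]_(n, p)) :
  nsq (w^t* *m U) <= nsq w * nsq U.
Proof.
have ww : w^t* *m w = (nsq w)%:C%:M.
  by rewrite [LHS]mx11_scalar -/(braket w w) -hs_braket hs_nsq.
have [w0|w0] := eqVneq (nsq w) 0.
  by rewrite (nsq_eq0 w0) trmx0 map_mx0 mul0mx !nsq0 mul0r.
have wgt0 : 0 < nsq w by rewrite lt_def w0 nsq_ge0.
have := nsq_ge0 ((nsq w)%:C *: U - w *m (w^t* *m U)).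
rewrite nsqB nsqZ ripZl nsq_mulmx ww.
have -> : rip U (w *m (w^t* *m U)) = nsq (w^t* *m U).
  by rewrite /rip hs_adjr.
rewrite mul_scalar_mx ripZr -/(nsq _) => h.
rewrite -subr_ge0 -(pmulr_rge0 _ wgt0); nra.
Qed.

Lemma nsq_mulcV_le m n (U : 'M[C]_(m, n)) (w : 'cV[C]_n) :
  nsq (U *m w) <= nsq U * nsq w.
Proof.
rewrite -nsq_adj adjM mulrC -(nsq_adj U).
exact: nsq_braket_le.
Qed.

End HilbertSchmidt.

(** * Norms of amplified observables as bounds on sesquilinear forms *)

Section Amplification.
Variable R : realType.
Local Notation C := R[i].
Local Notation Re := complex.Re.

Lemma vnormE n (v : 'cV[C]_n) : vnorm v = Num.sqrt (nsq v).
Proof. by rewrite /vnorm -hs_braket. Qed.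

Lemma opnorm_has_sup m n (A : 'M[C]_(m, n)) :
  has_sup [set vnorm (A *m v) | v in [set v | vnorm v <= 1]].
Proof.
split; first by exists (vnorm (A *m 0)), 0 => //=; rewrite vnormE nsq0 sqrtr0.
exists (Num.sqrt (nsq A)) => _ [v /= v1 <-].
rewrite vnormE ler_wsqrtr // (le_trans (nsq_mulcV_le _ _)) //.
rewrite ler_piMr ?nsq_ge0 // -(sqr_sqrtr (nsq_ge0 v)) -vnormE.
by rewrite expr_le1 // sqrtr_ge0.
Qed.

Lemma opnorm_ge0 m n (A : 'M[C]_(m, n)) : 0 <= opnorm A.
Proof.
apply: (@le_trans _ _ (vnorm (A *m 0))); first exact: sqrtr_ge0.
apply: (ub_le_sup (opnorm_has_sup A).2).
by exists 0 => //=; rewrite vnormE nsq0 sqrtr0.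
Qed.

Lemma nsq_opnorm m n (A : 'M[C]_(m, n)) (v : 'cV[C]_n) :
  nsq (A *m v) <= opnorm A ^+ 2 * nsq v.
Proof.
have [v0|v0] := eqVneq (nsq v) 0.
  by rewrite (nsq_eq0 v0) mulmx0 !nsq0 mulr0.
have vgt0 : 0 < nsq v by rewrite lt_def v0 nsq_ge0.
have sgt0 : 0 < Num.sqrt (nsq v) by rewrite sqrtr_gt0.
pose t := (Num.sqrt (nsq v))^-1.
have t2 : t ^+ 2 * nsq v = 1.
  by rewrite -{1}(sqr_sqrtr (nsq_ge0 v)) -exprMn mulVf ?expr1n ?gt_eqF.
have : vnorm (A *m (t%:C *: v)) <= opnorm A.
  apply: (ub_le_sup (opnorm_has_sup A).2).
  by exists (t%:C *: v) => //=; rewrite vnormE nsqZ t2 sqrtr1.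
rewrite vnormE -(ler_pXn2r (n := 2)) // ?nnegrE ?sqrtr_ge0 ?opnorm_ge0 //.
rewrite sqr_sqrtr ?nsq_ge0 // -scalemxAr nsqZ => h.
rewrite -[X in X <= _]mul1r -t2 mulrAC.
by rewrite ler_wpM2r ?nsq_ge0.
Qed.

(** Expand |c u - A v|^2 >= 0 and divide by c; if c = 0, then A v = 0. *)
Lemma opnorm_rip m n (A : 'M[C]_(m, n)) c (u : 'cV[C]_m) (v : 'cV[C]_n) :
  opnorm A <= c -> 2 * rip u (A *m v) <= c * (nsq u + nsq v).
Proof.
move=> Ac; have c0 := le_trans (opnorm_ge0 A) Ac.
have := nsq_opnorm A v.
have : opnorm A ^+ 2 * nsq v <= c ^+ 2 * nsq v.
  by rewrite ler_wpM2r ?nsq_ge0 // ler_sqr ?nnegrE ?opnorm_ge0.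
move=> h1 h2; have {h1 h2} := le_trans h2 h1.
have [-> {Ac c0}|cn0] := eqVneq c 0.
  rewrite expr0n mul0r => h.
  have /nsq_eq0 -> : nsq (A *m v) = 0 by apply/eqP; rewrite eq_le h nsq_ge0.
  by rewrite /rip /hs mulmx0 raddf0 mulr0 mul0r.
have cgt0 : 0 < c by rewrite lt_def cn0.
move=> h; have := nsq_ge0 (c%:C *: u - A *m v).
rewrite nsqB nsqZ ripZl => h'.
rewrite -subr_ge0 -(pmulr_rge0 _ cgt0); nra.
Qed.

Lemma opnorm_le m n (A : 'M[C]_(m, n)) c : 0 <= c ->
  (forall (u : 'cV_m) (v : 'cV_n), 2 * rip u (A *m v) <= c * (nsq u + nsq v)) -> opnorm A <= c.
Proof.
move=> c0 h; apply: ge_sup; first exact: (opnorm_has_sup A).1.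
move=> _ [v /= v1 <-].
have {}v1 : nsq v <= 1.
  rewrite -(sqr_sqrtr (nsq_ge0 v)) -vnormE expr_le1 //; exact: sqrtr_ge0.
rewrite vnormE -(ler_pXn2r (n := 2)) // ?nnegrE ?sqrtr_ge0 //.
rewrite sqr_sqrtr ?nsq_ge0 //.
have hh t : 2 * t * nsq (A *m v) <= c * (t ^+ 2 * nsq (A *m v) + nsq v).
  by have := h (t%:C *: (A *m v)) v; rewrite ripZl nsqZ mulrA.
have [c00|cn0] := eqVneq c 0.
  have := hh 1; rewrite c00 expr0n /= mul0r; lra.
have cgt0 : 0 < c by rewrite lt_def cn0.
(* The test vector u = c^-1 A v balances the two sides: c^-1 |A v|^2 <= c |v|^2. *)
have h1 := hh c^-1.
have e : c * (c ^- 2 * nsq (A *m v) + nsq v)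
         = c^-1 * nsq (A *m v) + c * nsq v by field.
rewrite exprVn e in h1.
have h2 : c^-1 * nsq (A *m v) <= c * nsq v by lra.
have h3 : nsq (A *m v) <= c ^+ 2 * nsq v.
  by rewrite expr2 -mulrA -ler_pdivrMl.
apply: (le_trans h3); rewrite ler_piMr // exprn_ge0 //.
Qed.

(* A vector of C^n (x) C^h is represented by the h x n matrix of its components,
   so that [1 (x) A] acts on it as [A *m _]. *)
Definition aform S n (a : 'M[obs R S]_n) (y : values S)
    (V W : 'M[C]_(hdim S, n)) : C :=
  \sum_i \sum_j braket (col i V) (a i j y *m col j W).

Definition stack h n (V : 'M[C]_(h, n)) : 'cV[C]_(\sum_(i < n) h) :=
  \mxcol_i col i V.

Definition unstack h n (v : 'cV[C]_(\sum_(i < n) h)) : 'M[C]_(h, n) :=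
  \matrix_(r, i) submxcol v i r 0.

Lemma unstackK h n (v : 'cV[C]_(\sum_(i < n) h)) : stack (unstack v) = v.
Proof.
rewrite -[RHS]submxcolK; apply: eq_mxcol => i; apply/matrixP => r k.
by rewrite !mxE ord1.
Qed.

Lemma adj_mxcol h n (B : 'I_n -> 'cV[C]_h) :
  (\mxcol_i B i)^t* = \mxrow_i (B i)^t*.
Proof. by apply/matrixP => i j; rewrite !mxE. Qed.

Lemma hs_stack h n (V W : 'M[C]_(h, n)) : hs (stack V) (stack W) = hs V W.
Proof.
rewrite {1}/hs /stack adj_mxcol mul_mxrow_mxcol raddf_sum hs_col.
by apply: eq_bigr => i _; rewrite -hs_braket.
Qed.

Lemma aformE S n (a : 'M[obs R S]_n) y V W :
  braket (stack V) (amp_at a y *m stack W) = aform a y V W.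
Proof.
rewrite -hs_braket /hs /stack /amp_at adj_mxcol.
have -> : \mxblock_(i, j) a i j y *m \mxcol_j col j W =
          \mxcol_i (\sum_j a i j y *m col j W).
  by rewrite mxblockEv mxcol_mul; apply: eq_mxcol => i; rewrite mul_mxrow_mxcol.
rewrite mul_mxrow_mxcol raddf_sum; apply: eq_bigr => i _.
rewrite mulmx_sumr raddf_sum; apply: eq_bigr => j _.
by rewrite -hs_braket.
Qed.

Lemma amp_posP S n (a : 'M[obs R S]_n) :
  amp_pos a <-> forall y V, 0 <= aform a y V V.
Proof.
split=> [h y V|h y v]; first by rewrite -aformE; apply: h.
by rewrite -(unstackK v) aformE; apply: h.
Qed.

Lemma nsq_stack h n (V : 'M[C]_(h, n)) : nsq (stack V) = nsq V.
Proof. by rewrite /nsq /rip hs_stack. Qed.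

(* Operator norm at most [c], by a polarised inequality that can be summed over
   Kraus operators without square roots. *)
Definition amp_bounded S n (a : 'M[obs R S]_n) (c : R) :=
  forall y V W, 2 * Re (aform a y V W) <= c * (nsq V + nsq W).

Lemma amp_norm_ge0 S n (a : 'M[obs R S]_n) : 0 <= amp_norm a.
Proof. by rewrite /amp_norm; elim/big_ind: _ => // [x y x0 _|y _]; rewrite ?le_max ?x0 ?opnorm_ge0. Qed.

Lemma amp_norm_boundedP S n (a : 'M[obs R S]_n) c : 0 <= c ->
  amp_norm a <= c <-> amp_bounded a c.
Proof.
move=> c0; split=> [h y V W|h].
  rewrite -aformE -hs_braket -/(rip _ _) -(nsq_stack V) -(nsq_stack W).
  apply: opnorm_rip; apply: le_trans h.
  by rewrite /amp_norm (bigD1 y) //= le_max lexx.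
rewrite /amp_norm; elim/big_ind: _ => // [x z xc zc|y _].
  by rewrite ge_max xc.
apply: opnorm_le => // u v; rewrite -(unstackK u) -(unstackK v) !nsq_stack.
by rewrite /rip hs_braket aformE.
Qed.

End Amplification.

(** * Positive matrices, Choi matrices and Kraus decompositions *)

Section Kraus.
Variable R : realType.
Local Notation C := R[i].

Lemma adjE m n (A : 'M[C]_(m, n)) i j : A^t* i j = Num.conj (A j i).
Proof. by rewrite !mxE. Qed.

Lemma braket_delta n (A : 'M[C]_n) i j :
  braket (delta_mx i 0) (A *m delta_mx j 0) = A i j.
Proof.
rewrite /braket -colE mxE (bigD1 i) //= big1 => [|k ki].
  by rewrite !mxE !eqxx rmorph1 mul1r addr0.
by rewrite !mxE (negbTE ki) rmorph0 mul0r.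
Qed.

Lemma braketDZ n (D : 'M[C]_n) (u v : 'cV[C]_n) c :
  braket (u + c *: v) (D *m (u + c *: v)) =
  braket u (D *m u) + c * braket u (D *m v) + Num.conj c * braket v (D *m u)
  + Num.conj c * c * braket v (D *m v).
Proof.
rewrite -!hs_braket mulmxDr -scalemxAr hsDl !hsDr !hsZl !hsZr.
move: (hs u _) (hs u _) (hs v _) (hs v _) (Num.conj c) => p q r s c'.
by rewrite mulrA addrA.
Qed.

(** Polarisation over the complex numbers: on e_i + c e_j, the choices c = 1 and c = i give D i j +
    D j i = 0 and D i j - D j i = 0. *)
Lemma braket_eq0_mx n (D : 'M[C]_n) :
  (forall v, braket v (D *m v) = 0) -> D = 0.
Proof.
move=> D0; apply/matrixP => i j; rewrite mxE.
have h c : c * D i j + Num.conj c * D j i = 0.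
  have := D0 (delta_mx i 0 + c *: delta_mx j 0).
  by rewrite braketDZ !D0 !braket_delta add0r mulr0 addr0.
have h1 := h 1; have hi := h 'i%R.
rewrite rmorph1 !mul1r in h1; rewrite conjCi mulNr in hi.
have /mulfI hI : 'i%R != 0 :> C by rewrite neq0Ci.
have : 2 * D i j = 0.
  have -> : 2 * D i j = (D i j + D j i) + (D i j - D j i) by ring.
  rewrite h1 add0r; apply: hI; rewrite mulr0 mulrBr; exact: hi.
by move/eqP; rewrite mulf_eq0 pnatr_eq0 /= => /eqP.
Qed.

(** Each <v, A v> is real, so the quadratic form of A - A^* vanishes. *)
Lemma psdmx_herm n (A : 'M[C]_n) : psdmx A -> A \is hermsymmx.
Proof.
move=> Apsd; apply/is_hermitianmxP; rewrite expr0 scale1r.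
apply/eqP; rewrite -subr_eq0; apply/eqP; apply: braket_eq0_mx => v.
rewrite mulmxBl -!hs_braket hsDr hsNr.
have -> : hs v (A^t* *m v) = hs v (A *m v).
  by rewrite -hs_adjl -hs_conj (geC0_conj _) // hs_braket; apply: Apsd.
by rewrite subrr.
Qed.

Lemma psdmx_root n (A : 'M[C]_n) : psdmx A -> exists B : 'M[C]_n, A = B *m B^t*.
Proof.
move=> Apsd.
have /hermitian_normalmx /orthomx_spectralP := psdmx_herm Apsd.
set P := spectralmx A; set s := spectral_diag A => eA.
have Pu : P \is unitarymx by apply: spectral_unitarymx.
rewrite invmx_unitary // in eA.
have PP : P *m P^t* = 1%:M by apply/unitarymxP.
have s_ge0 i : 0 <= s 0 i.
  have := Apsd (P^t* *m delta_mx i 0).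
  rewrite {1}eA -hs_braket hs_adjl trmxCK !mulmxA PP mul1mx.
  rewrite -!mulmxA (mulmxA P) PP mul1mx hs_braket braket_delta.
  by rewrite mxE eqxx mulr1n.
pose r : 'rV[C]_n := \row_i sqrtC (s 0 i).
have r_adj : (diag_mx r)^t* = diag_mx r.
  apply/matrixP => i j; rewrite adjE !mxE rmorphMn /= eq_sym.
  rewrite geC0_conj ?sqrtC_ge0 //.
  by case: eqP => [->|].
exists (P^t* *m diag_mx r); rewrite adjM trmxCK r_adj [LHS]eA.
have -> : diag_mx s = diag_mx r *m diag_mx r.
  apply/matrixP => i j; rewrite mul_diag_mx !mxE.
  by case: eqP => [->|]; rewrite ?mulr0n ?mulr0 ?mulr1n // -expr2 sqrtCK.
move: (P^t*) (diag_mx r) => P' D.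
by rewrite (mulmxA P' D D) -[LHS]mulmxA.
Qed.

Lemma linear_sumZ (U V : lmodType C) (T : U -> V) (I : finType)
    (c : I -> C) (f : I -> U) : linear T ->
  T (\sum_i c i *: f i) = \sum_i c i *: T (f i).
Proof.
move=> lT; have T0 : T 0 = 0.
  have := lT 1 0 0; rewrite !scale1r addr0 => /eqP.
  by rewrite -subr_eq subrr => /eqP <-.
elim/big_rec2: _ => // i x y _ <-; exact: lT.
Qed.

Definition unit_obs S (y : values S) (i j : 'I_(hdim S)) : obs R S :=
  [ffun y' => if y' == y then delta_mx i j else 0].

Lemma obs_sum S (a : obs R S) :
  a = \sum_(p : values S * ('I_(hdim S) * 'I_(hdim S)))
         a p.1 p.2.1 p.2.2 *: unit_obs p.1 p.2.1 p.2.2.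
Proof.
apply/ffunP => y; rewrite sum_ffunE; under eq_bigr do rewrite !ffunE.
rewrite -(pair_big predT predT (fun y' p =>
   a y' p.1 p.2 *: if y == y' then delta_mx p.1 p.2 else 0)) /=.
rewrite (bigD1 y) //= [X in _ + X]big1 => [|y' yy']; last first.
  by apply: big1 => p _; rewrite eq_sym (negbTE yy') scaler0.
rewrite eqxx addr0 [LHS]matrix_sum_delta pair_big /=.
by apply: eq_bigr.
Qed.

(** At [y] the form is |tr V|^2: this is the unnormalised maximally entangled state, whose image
    under an amplified map is the Choi matrix. *)
Lemma amp_pos_unit S (y : values S) :
  amp_pos (\matrix_(i, j) unit_obs y i j).
Proof.
apply/amp_posP => y' V; rewrite /aform.
have [->|yy'] := eqVneq y' y; last first.
  rewrite big1 // => i _; rewrite big1 // => j _; rewrite mxE ffunE (negbTE yy').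
  by rewrite mul0mx -hs_braket /hs mulmx0 raddf0.
set z := \sum_i V i i; suff -> : \sum_i \sum_j braket (col i V)
   ((\matrix_(i, j) unit_obs y i j) i j y *m col j V) = z * Num.conj z.
  exact: mul_conjC_ge0.
rewrite mulrC /z rmorph_sum mulr_suml; apply: eq_bigr => i _.
rewrite mulr_sumr; apply: eq_bigr => j _; rewrite mxE ffunE eqxx.
rewrite /braket mxE (bigD1 i) //= big1 => [|k ki].
  rewrite !mxE addr0; congr (_ * _); rewrite (bigD1 j) //= big1 => [|k kj].
    by rewrite !mxE !eqxx mul1r addr0.
  by rewrite !mxE (negbTE kj) andbF mul0r.
rewrite !mxE big1 ?mulr0 // => l _.
by rewrite !mxE (negbTE ki) mul0r.
Qed.

(** A Kraus operator reads only one classical value of the output system. Recording it in [pt] lets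
    a single index set J cover all values, so that hybrid systems need no double sums. *)
Definition kraus S S' (T : obs R S -> obs R S') (J : finType)
    (pt : J -> values S) (A : values S' -> J -> 'M[C]_(hdim S, hdim S')) :=
  forall a y', T a y' = \sum_j (A y' j)^t* *m a (pt j) *m A y' j.

(* The components of the Choi matrix of [T] are positive, and the columns of
   their square roots are the Kraus operators. *)
Lemma cp_kraus S S' (T : obs R S -> obs R S') :
  linear T -> completely_positive T -> exists J pt A, @kraus S S' T J pt A.
Proof.
move=> lT cpT.
pose choi (y : values S) : 'M[obs R S']_(hdim S) :=
  map_mx T (\matrix_(i, j) unit_obs y i j).
have psd_choi p : exists B : 'M_(\sum_(i < hdim S) hdim S'),
    amp_at (choi p.1) p.2 = B *m B^t*.
  exact: psdmx_root (cpT _ _ (amp_pos_unit p.1) p.2).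
have [B hB] := choice psd_choi.
exists (values S * 'I_(\sum_(i < hdim S) hdim S'))%type, fst.
(* The conjugate is there because [A^t* *m delta_mx i j *m A] has entries conj (A i r) A j s, to be
   matched with the entries B_(i,r) conj B_(j,s) of B B^*. *)
exists (fun y' j => \matrix_(i, r) Num.conj (B (j.1, y') (tagnat.Rank i r) j.2)).
move=> a y'; rewrite {1}(obs_sum a) linear_sumZ // sum_ffunE.
rewrite -(pair_big predT predT (fun y (k : 'I__) =>
  let A : 'M_(hdim S, hdim S') :=
    \matrix_(i, r) Num.conj (B (y, y') (tagnat.Rank i r) k) in
  A^t* *m a y *m A)) /=.
rewrite -(pair_big predT predT (fun y (q : 'I_(hdim S) * 'I_(hdim S)) =>
  (a y q.1 q.2 *: T (unit_obs y q.1 q.2)) y')) /=.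
apply: eq_bigr => y _.
rewrite -(pair_big predT predT (fun i j => (a y i j *: T (unit_obs y i j)) y')) /=.
apply/matrixP => r s.
have choiE i j : T (unit_obs y i j) y' r s =
    \sum_k B (y, y') (tagnat.Rank i r) k * Num.conj (B (y, y') (tagnat.Rank j s) k).
  transitivity (submxblock (amp_at (choi y) y') i j r s).
    by rewrite mxblockK !mxE.
  by rewrite (hB (y, y')) !mxE; apply: eq_bigr => k _; rewrite adjE.
have krausE (k : 'I_(\sum_(i < hdim S) hdim S')) :
    let A : 'M_(hdim S, hdim S') :=
      \matrix_(i, r) Num.conj (B (y, y') (tagnat.Rank i r) k) in
    (A^t* *m a y *m A) r s = \sum_i \sum_j a y i j *
      (B (y, y') (tagnat.Rank i r) k * Num.conj (B (y, y') (tagnat.Rank j s) k)).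
  rewrite /= mxE [RHS]exchange_big; apply: eq_bigr => j _.
  rewrite mxE mulr_suml; apply: eq_bigr => i _.
  by rewrite !mxE conjCK mulrCA mulrA.
rewrite !summxE [RHS](eq_bigr _ (fun k _ => krausE k)) exchange_big /=.
apply: eq_bigr => i _; rewrite summxE exchange_big /=.
by apply: eq_bigr => j _; rewrite ffunE mxE choiE mulr_sumr.
Qed.

Lemma col_mul m n p (A : 'M[C]_(m, n)) (B : 'M[C]_(n, p)) j :
  col j (A *m B) = A *m col j B.
Proof. by rewrite !colE mulmxA. Qed.

(** Kraus operators multiply vectors from the left and leave the amplifying factor alone; this makes
    all later estimates uniform in n. *)
Lemma kraus_aform S S' (T : obs R S -> obs R S') J pt A :
  @kraus S S' T J pt A -> forall n (a : 'M[obs R S]_n) y V W,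
  aform (map_mx T a) y V W =
  \sum_j aform a (pt j) (A y j *m V) (A y j *m W).
Proof.
move=> kT n a y V W; rewrite /aform [RHS]exchange_big /=.
apply: eq_bigr => i _; rewrite [RHS]exchange_big /=; apply: eq_bigr => k _.
rewrite mxE kT mulmx_suml -hs_braket hs_sumr; apply: eq_bigr => j _.
by rewrite -!mulmxA hs_adjr trmxCK !col_mul hs_braket.
Qed.

Lemma kraus_cp S S' (T : obs R S -> obs R S') J pt A :
  @kraus S S' T J pt A -> completely_positive T.
Proof.
move=> kT n a /amp_posP a0; apply/amp_posP => y V.
by rewrite (kraus_aform kT) sumr_ge0.
Qed.

Lemma kraus_linear S S' (T : obs R S -> obs R S') J pt A :
  @kraus S S' T J pt A -> linear T.
Proof.
move=> kT c a a'; apply/ffunP => y; rewrite !ffunE !kT scaler_sumr -big_split.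
apply: eq_bigr => j _ /=; rewrite !ffunE mulmxDr mulmxDl.
by rewrite -scalemxAr -scalemxAl.
Qed.

(** Unitality means that the stacked Kraus operators form an isometry, the Stinespring dilation. *)
Lemma kraus_unital_nsq S S' (T : obs R S -> obs R S') J pt A :
  @kraus S S' T J pt A -> T (obs1 R S) = obs1 R S' ->
  forall n y (V : 'M_(_, n)), \sum_j nsq (A y j *m V) = nsq V.
Proof.
move=> kT T1 n y V; under eq_bigr do rewrite nsq_mulmx.
have : \sum_j (A y j)^t* *m A y j = 1%:M.
  transitivity (T (obs1 R S) y); last by rewrite T1 ffunE.
  by rewrite kT; apply: eq_bigr => j _; rewrite ffunE mulmx1.
rewrite /rip -Re_sum -hs_sumr -mulmx_suml => ->.
by rewrite mul1mx.
Qed.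

Lemma channel_kraus S S' (T : obs R S -> obs R S') :
  channel T -> exists J pt A, @kraus S S' T J pt A.
Proof. by case=> lT _ cpT; apply: cp_kraus. Qed.

(** Channels are complete contractions: sum the polarised bound over the Kraus operators, and the
    isometry identity restores the squared norms. *)
Lemma channel_bounded S S' (T : obs R S -> obs R S') n (a : 'M[obs R S]_n) c :
  channel T -> amp_bounded a c -> amp_bounded (map_mx T a) c.
Proof.
move=> chT ac y V W; have [J [pt [A kT]]] := channel_kraus chT.
have [_ T1 _] := chT.
rewrite (kraus_aform kT) Re_sum mulr_sumr.
rewrite -(kraus_unital_nsq kT T1 y V) -(kraus_unital_nsq kT T1 y W).
by rewrite -big_split mulr_sumr; apply: ler_sum => j _; apply: ac.
Qed.

End Kraus.

(** * Completely bounded norm, distinguishability and composition *)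

Section CbNorm.
Variable R : realType.
Local Notation C := R[i].
Local Notation Re := complex.Re.

(** A bound on the cb norm free of suprema. As [sup] has a default value on unbounded sets,
    [cb_norm T <= c] is informative only once some such bound is known. *)
Definition cb_le S S' (T : obs R S -> obs R S') (c : R) :=
  forall n (a : 'M[obs R S]_n), amp_bounded a 1 -> amp_bounded (map_mx T a) c.

Lemma amp_bounded0 S n : amp_bounded (0 : 'M[obs R S]_n) 1.
Proof.
move=> y V W; rewrite /aform big1 => [|i _].
  by rewrite mulr0 mul1r addr_ge0 ?nsq_ge0.
rewrite big1 // => j _.
by rewrite mxE ffunE mul0mx -hs_braket /hs mulmx0 raddf0.
Qed.

Lemma amplification_norm_ub S S' (T : obs R S -> obs R S') c n : cb_le T c ->
  0 <= c -> ubound [set amp_norm (map_mx T a) | a in [set a : 'M_n | amp_norm a <= 1]] c.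
Proof.
move=> Tc c0 _ [a /= a1 <-].
by apply/(amp_norm_boundedP _ c0)/Tc/(amp_norm_boundedP _ ler01).
Qed.

Lemma amplification_norm_le S S' (T : obs R S -> obs R S') c n : cb_le T c ->
  0 <= c -> amplification_norm T n <= c.
Proof.
move=> Tc c0; apply: ge_sup; last exact: amplification_norm_ub.
exists (amp_norm (map_mx T (0 : 'M_n))), 0 => //=.
by apply/(amp_norm_boundedP _ ler01)/amp_bounded0.
Qed.

Lemma cb_norm_le S S' (T : obs R S -> obs R S') c : cb_le T c ->
  0 <= c -> cb_norm T <= c.
Proof.
move=> Tc c0; apply: ge_sup; first by exists (amplification_norm T 0), 0%N.
by move=> _ [n _ <-]; apply: amplification_norm_le.
Qed.

Lemma amp_norm_le_cb S S' (T : obs R S -> obs R S') c n (a : 'M_n) :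
  cb_le T c -> 0 <= c -> amp_bounded a 1 -> amp_norm (map_mx T a) <= cb_norm T.
Proof.
move=> Tc c0 a1; apply: (@le_trans _ _ (amplification_norm T n)).
  apply: ub_le_sup; first by exists c; apply: amplification_norm_ub.
  by exists a => //=; apply/(amp_norm_boundedP _ ler01).
apply: ub_le_sup; last by exists n.
by exists c => _ [m _ <-]; apply: amplification_norm_le.
Qed.

Lemma cb_norm_ge0 S S' (T : obs R S -> obs R S') c :
  cb_le T c -> 0 <= c -> 0 <= cb_norm T.
Proof.
move=> Tc c0; apply: le_trans (amp_norm_le_cb Tc c0 (@amp_bounded0 S 0)).
exact: amp_norm_ge0.
Qed.

Lemma cb_le_norm S S' (T : obs R S -> obs R S') c :
  cb_le T c -> 0 <= c -> cb_le T (cb_norm T).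
Proof.
move=> Tc c0 n a a1; apply/(amp_norm_boundedP _ (cb_norm_ge0 Tc c0)).
exact: amp_norm_le_cb Tc c0 a1.
Qed.

Lemma aformD S n (a a' : 'M[obs R S]_n) y V W :
  aform (a + a') y V W = aform a y V W + aform a' y V W.
Proof.
rewrite /aform -big_split; apply: eq_bigr => i _.
rewrite -big_split; apply: eq_bigr => j _ /=.
by rewrite mxE ffunE mulmxDl -!hs_braket hsDr.
Qed.

Lemma aformN S n (a : 'M[obs R S]_n) y V W :
  aform (- a) y V W = - aform a y V W.
Proof.
rewrite /aform -sumrN; apply: eq_bigr => i _.
rewrite -sumrN; apply: eq_bigr => j _ /=.
by rewrite mxE ffunE mulNmx -!hs_braket hsNr.
Qed.

Lemma aformVB S n (a : 'M[obs R S]_n) y V V' W :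
  aform a y (V - V') W = aform a y V W - aform a y V' W.
Proof.
rewrite /aform -sumrB; apply: eq_bigr => i _.
rewrite -sumrB; apply: eq_bigr => j _ /=.
by rewrite linearB /= -!hs_braket hsDl hsNl.
Qed.

Lemma aformWB S n (a : 'M[obs R S]_n) y V W W' :
  aform a y V (W - W') = aform a y V W - aform a y V W'.
Proof.
rewrite /aform -sumrB; apply: eq_bigr => i _.
rewrite -sumrB; apply: eq_bigr => j _ /=.
by rewrite linearB /= mulmxBr -!hs_braket hsDr hsNr.
Qed.

Lemma aformZl S n (a : 'M[obs R S]_n) y c V W :
  aform a y (c *: V) W = Num.conj c * aform a y V W.
Proof.
rewrite /aform mulr_sumr; apply: eq_bigr => i _.
rewrite mulr_sumr; apply: eq_bigr => j _ /=.
by rewrite linearZ /= -!hs_braket hsZl.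
Qed.

Lemma aformNl S n (a : 'M[obs R S]_n) y V W :
  aform a y (- V) W = - aform a y V W.
Proof. by rewrite -scaleN1r aformZl rmorphN1 mulN1r. Qed.

Lemma amp_boundedD S n (a a' : 'M[obs R S]_n) c c' :
  amp_bounded a c -> amp_bounded a' c' -> amp_bounded (a + a') (c + c').
Proof.
move=> ac ac' y V W; rewrite aformD ReD [leLHS]mulrDr [leRHS]mulrDl.
by apply: lerD; [apply: ac | apply: ac'].
Qed.

Lemma amp_boundedN S n (a : 'M[obs R S]_n) c :
  amp_bounded a c -> amp_bounded (- a) c.
Proof.
move=> ac y V W; have := ac y (- V) W.
by rewrite nsqN aformNl aformN.
Qed.

(** Rescaling U by e^-1 in the polarised bound gives weighted AM-GM, which replaces Cauchy-Schwarz: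
    a small U is compensated by a small e. *)
Lemma aform_le S n (a : 'M[obs R S]_n) y (U W : 'M_(hdim S, n)) e :
  0 < e -> amp_bounded a 1 ->
  2 * Re (aform a y U W) <= e^-1 * nsq U + e * nsq W.
Proof.
move=> e0 a1; have := a1 y (e^-1%:C *: U) W.
rewrite aformZl conj_real Re_realM nsqZ mul1r => h.
rewrite -(ler_pM2l (x := e^-1)) ?invr_gt0 // mulrDr !mulrA mulVf ?gt_eqF //.
by rewrite mul1r -expr2 (mulrC e^-1 2) -mulrA.
Qed.

Lemma aform_le' S n (a : 'M[obs R S]_n) y (U W : 'M_(hdim S, n)) e :
  0 < e -> amp_bounded a 1 ->
  2 * Re (aform a y U W) <= e * nsq U + e^-1 * nsq W.
Proof.
move=> e0 a1; have := @aform_le _ _ a y U W e^-1.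
by rewrite invrK; apply=> //; rewrite invr_gt0.
Qed.

Lemma aform_diff_le S n (a : 'M[obs R S]_n) y (U U' W W' : 'M_(hdim S, n)) e :
  0 < e -> amp_bounded a 1 ->
  2 * Re (aform a y U W - aform a y U' W') <=
  e^-1 * nsq (U - U') + e * nsq W + (e * nsq U' + e^-1 * nsq (W - W')).
Proof.
move=> e0 a1.
have -> : aform a y U W - aform a y U' W' =
    aform a y (U - U') W + aform a y U' (W - W').
  by rewrite aformVB aformWB addrA subrK.
rewrite ReD [leLHS]mulrDr.
by apply: lerD; [apply: aform_le | apply: aform_le'].
Qed.

Lemma map_mxB_fun S S' (T T' : obs R S -> obs R S') n (a : 'M[obs R S]_n) :
  map_mx (fun a => T a - T' a) a = map_mx T a - map_mx T' a.
Proof. by apply/matrixP => i j; rewrite !mxE. Qed.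

Lemma cb_leB S S' (T T' : obs R S -> obs R S') c c' :
  cb_le T c -> cb_le T' c' -> cb_le (fun a => T a - T' a) (c + c').
Proof.
move=> Tc Tc' n a a1; rewrite map_mxB_fun; apply: amp_boundedD; first exact: Tc.
by apply: amp_boundedN; apply: Tc'.
Qed.

Lemma cb_leD S S' (T T' : obs R S -> obs R S') c c' :
  cb_le T c -> cb_le T' c' -> cb_le (fun a => T a + T' a) (c + c').
Proof.
move=> Tc Tc' n a a1.
have -> : map_mx (fun a => T a + T' a) a = map_mx T a + map_mx T' a.
  by apply/matrixP => i j; rewrite !mxE.
by apply: amp_boundedD; [apply: Tc | apply: Tc'].
Qed.

Lemma cb_le_swap S S' (T T' : obs R S -> obs R S') c :
  cb_le (fun a => T a - T' a) c -> cb_le (fun a => T' a - T a) c.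
Proof.
move=> Tc n a a1; rewrite map_mxB_fun -opprB -map_mxB_fun.
by apply: amp_boundedN; apply: Tc.
Qed.

Lemma channel_cb_le S S' (T : obs R S -> obs R S') : channel T -> cb_le T 1.
Proof. by move=> chT n a a1; apply: channel_bounded. Qed.

Lemma cb_le_comp S S' S'' (M : obs R S -> obs R S') (T : obs R S' -> obs R S'') c :
  channel M -> cb_le T c -> cb_le (T \o M) c.
Proof.
move=> chM Tc n a a1; rewrite map_mx_comp; apply: Tc.
exact: channel_bounded.
Qed.

Lemma cb_le_compl S S' S'' (T : obs R S -> obs R S') (P : obs R S' -> obs R S'') c :
  channel P -> cb_le T c -> cb_le (P \o T) c.
Proof.
move=> chP Tc n a a1; rewrite map_mx_comp.
by apply: channel_bounded => //; apply: Tc.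
Qed.

Lemma cb_le_ext S S' (T T' : obs R S -> obs R S') c :
  T =1 T' -> cb_le T c -> cb_le T' c.
Proof.
move=> TT' Tc n a a1; rewrite -(eq_map_mx _ TT'); exact: Tc.
Qed.

Lemma channel_comp S S' S'' (M : obs R S -> obs R S') (T : obs R S' -> obs R S'') :
  channel M -> channel T -> channel (T \o M).
Proof.
move=> [lM M1 cM] [lT T1 cT]; split=> [c u v||n a a0] /=.
- by rewrite lM lT.
- by rewrite M1.
- by rewrite map_mx_comp; apply: cT; apply: cM.
Qed.

Lemma linear_opB (U V : lmodType C) (T : U -> V) u v :
  linear T -> T (u - v) = T u - T v.
Proof. move=> lT; rewrite (addrC u) -(scaleN1r v) lT scaleN1r. by rewrite addrC. Qed.

Lemma distinguishability_cb_le S S' (E1 E2 : obs R S -> obs R S') :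
  channel E1 -> channel E2 ->
  cb_le (fun a => E1 a - E2 a) (2 * distinguishability E1 E2).
Proof.
move=> ch1 ch2; rewrite mulrA divff ?mul1r ?pnatr_eq0 //.
(* The crude bound 1 + 1, from two contractions, serves only to make the suprema finite. *)
apply: (@cb_le_norm _ _ _ (1 + 1)); last exact: addr_ge0.
by apply: cb_leB; apply: channel_cb_le.
Qed.

Lemma distinguishability_le S S' (E1 E2 : obs R S -> obs R S') c : 0 <= c ->
  cb_le (fun a => E1 a - E2 a) (2 * c) -> distinguishability E1 E2 <= c.
Proof.
move=> c0 Ec; rewrite /distinguishability ler_pdivrMl ?ltr0n //.
by apply: cb_norm_le => //; rewrite mulr_ge0.
Qed.

Lemma distinguishability_ge0 S S' (E1 E2 : obs R S -> obs R S') :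
  channel E1 -> channel E2 -> 0 <= distinguishability E1 E2.
Proof.
move=> ch1 ch2; rewrite mulr_ge0 ?invr_ge0 //.
apply: (@cb_norm_ge0 _ _ _ (1 + 1)); last exact: addr_ge0.
by apply: cb_leB; apply: channel_cb_le.
Qed.

Lemma distinguishability_triangle S S' (E1 E2 E3 : obs R S -> obs R S') c :
  channel E1 -> channel E2 -> 0 <= c -> cb_le (fun a => E2 a - E3 a) (2 * c) ->
  distinguishability E1 E3 <= distinguishability E1 E2 + c.
Proof.
move=> ch1 ch2 c0 h23; apply: distinguishability_le.
  by rewrite addr_ge0 // distinguishability_ge0.
rewrite mulrDr; apply: cb_le_ext (cb_leD (distinguishability_cb_le ch1 ch2) h23).
by move=> a /=; rewrite addrA subrK.
Qed.

Lemma kraus_channel S S' (T : obs R S -> obs R S') J pt A :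
  @kraus R S S' T J pt A ->
  (forall y, \sum_j (A y j)^t* *m A y j = 1%:M) -> channel T.
Proof.
move=> kT A1; split; [exact: kraus_linear kT| |exact: kraus_cp kT].
apply/ffunP => y; rewrite kT ffunE -[RHS](A1 y).
by apply: eq_bigr => j _; rewrite ffunE mulmx1.
Qed.

(** * Ideal devices and constant maps as channels *)

Lemma onb_resolution d (X : finType) (phi : X -> 'cV[C]_d) :
  orthonormal_basis phi -> \sum_x phi x *m (phi x)^t* = 1%:M.
Proof.
move=> [ortho span]; have phiE x x' : (phi x)^t* *m phi x' = (x == x')%:R%:M.
  by rewrite [LHS]mx11_scalar -/(braket _ _) ortho.
apply/eqP; rewrite -subr_eq0; apply/eqP; apply: braket_eq0_mx => v.
have [c ->] := span v; rewrite -hs_braket mulmxBl mul1mx.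
suff -> : (\sum_x phi x *m (phi x)^t*) *m (\sum_x c x *: phi x) =
   \sum_x c x *: phi x by rewrite subrr /hs mulmx0 raddf0.
rewrite mulmx_suml; apply: eq_bigr => x _.
rewrite mulmx_sumr (bigD1 x) //= big1 => [|x' xx'].
  by rewrite addr0 -scalemxAr -mulmxA phiE eqxx mulmx1.
by rewrite -scalemxAr -mulmxA phiE eq_sym (negbTE xx') raddf0 mulmx0 scaler0.
Qed.

Lemma measurement_kraus d (X : finType) (phi : X -> 'cV[C]_d) :
  @kraus R (classical X) (quantum d) (ideal_measurement phi) X id
    (fun _ x => (phi x)^t*).
Proof.
move=> f y; rewrite ffunE; apply: eq_bigr => x _.
by rewrite trmxCK [f x]mx11_scalar mul_mx_scalar -scalemxAl mxE mulr1n.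
Qed.

Lemma measurement_channel d (X : finType) (phi : X -> 'cV[C]_d) :
  orthonormal_basis phi -> channel (ideal_measurement phi).
Proof.
move=> onb; apply: kraus_channel (measurement_kraus phi) _ => _ /=.
by rewrite -[RHS](onb_resolution onb); apply: eq_bigr => x _; rewrite trmxCK.
Qed.

Lemma preparation_channel d (Z : finType) (theta : Z -> 'cV[C]_d) :
  orthonormal_basis theta -> channel (ideal_preparation theta).
Proof.
move=> [ortho _]; apply: (@kraus_channel (quantum d) (classical Z) _ unit id (fun z _ => theta z)).
  move=> a z; rewrite ffunE (big_pred1 tt) => [|[]//]; rewrite /braket.
  by rewrite mulmxA [RHS]mx11_scalar.
move=> z; rewrite (big_pred1 tt) => [|[]//]; rewrite [LHS]mx11_scalar.
by rewrite -/(braket _ _) ortho eqxx.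
Qed.

Lemma sum_delta n : \sum_(k < n) delta_mx k k = 1%:M :> 'M[C]_n.
Proof.
rewrite [RHS]matrix_sum_delta; apply: eq_bigr => i _.
rewrite (bigD1 i) //= big1 => [|j ji].
  by rewrite mxE eqxx scale1r addr0.
by rewrite mxE eq_sym (negbTE ji) scale0r.
Qed.

Lemma adj_delta m n i j : (delta_mx i j : 'M[C]_(m, n))^t* = delta_mx j i.
Proof. by rewrite trmx_delta; apply/matrixP => k l; rewrite !mxE rmorph_nat. Qed.

Lemma delta_sandwich m n (a : 'M[C]_m) i (k : 'I_n) :
  delta_mx k i *m a *m delta_mx i k = a i i *: delta_mx k k.
Proof.
have -> : a i i *: delta_mx k k = delta_mx k i *m (a i i *: delta_mx i k).
  by rewrite -scalemxAr mul_delta_mx.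
apply/matrixP => r s; rewrite -mulmxA; rewrite !mxE.
rewrite [LHS](bigD1 i) //= [RHS](bigD1 i) //=; congr (_ + _); last first.
  by apply: eq_bigr => j ji; rewrite !mxE (negbTE ji) andbF !mul0r.
rewrite !mxE (bigD1 i) //= !mxE eqxx /= big1 ?addr0 // => j ji.
by rewrite !mxE (negbTE ji) mulr0.
Qed.

Lemma tensor1_channel (Y : finType) b : channel (@tensor1 R Y b).
Proof.
(* The Kraus operators are the bras <k| of the standard basis of C^b: sum_k |k> f(y) <k| = f(y)
   1. *)
apply: (@kraus_channel (classical Y) (hybrid Y b) _ (Y * 'I_b)%type fst
  (fun y j => if j.1 == y then delta_mx 0 j.2 else 0)).
  move=> f y; rewrite ffunE.
  rewrite -(pair_big predT predT (fun y' k =>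
    (if y' == y then delta_mx 0 k else 0)^t* *m f y' *m
    (if y' == y then delta_mx 0 k else 0 : 'M[C]_(1, b)))) /=.
  rewrite (bigD1 y) //= [X in _ + X]big1 => [|y' yy'].
    rewrite eqxx addr0 -scalemx1 -(sum_delta b) scaler_sumr.
    by apply: eq_bigr => k _; rewrite adj_delta delta_sandwich.
  by rewrite (negbTE yy') big1 // => k _; rewrite mulmx0.
move=> y; rewrite -(pair_big predT predT (fun y' k =>
    (if y' == y then delta_mx 0 k else 0)^t* *m
    (if y' == y then delta_mx 0 k else 0 : 'M[C]_(1, b)))) /=.
rewrite (bigD1 y) //= [X in _ + X]big1 => [|y' yy'].
  rewrite eqxx addr0 -(sum_delta b); apply: eq_bigr => k _.
  by rewrite adj_delta mul_delta_mx.
by rewrite (negbTE yy') big1 // => k _; rewrite mulmx0.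
Qed.

(** The constant channel of the pure state |i0> at the value [y0]. It witnesses that the sets under
    the infima are nonempty. *)
Definition const_map S S' (y0 : values S) (i0 : 'I_(hdim S)) :
    obs R S -> obs R S' :=
  fun a => a y0 i0 i0 *: obs1 R S'.

Lemma const_map_channel S S' (y0 : values S) (i0 : 'I_(hdim S)) :
  channel (@const_map S S' y0 i0).
Proof.
apply: (@kraus_channel _ _ _ 'I_(hdim S') (fun=> y0) (fun _ k => delta_mx i0 k)).
  move=> a y'; rewrite !ffunE -(sum_delta (hdim S')) scaler_sumr.
  by apply: eq_bigr => k _; rewrite adj_delta delta_sandwich.
move=> y'; rewrite -(sum_delta (hdim S')); apply: eq_bigr => k _.
by rewrite adj_delta mul_delta_mx.
Qed.

Lemma const_map_constant S S' (y0 : values S) (i0 : 'I_(hdim S)) :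
  constant_channel (@const_map S S' y0 i0).
Proof.
split; first exact: const_map_channel.
exists (fun a : obs R S => a y0 i0 i0) => //; split=> [c a a'||a a0].
- by rewrite !ffunE !mxE.
- by rewrite ffunE mxE eqxx.
- by rewrite -braket_delta; apply: a0.
Qed.

Lemma channel_obs_pos S S' (T : obs R S -> obs R S') a :
  channel T -> obs_pos a -> obs_pos (T a).
Proof.
move=> chT a0 y v; have [J [pt [A kT]]] := channel_kraus chT.
rewrite kT mulmx_suml -hs_braket hs_sumr sumr_ge0 // => j _.
by rewrite -!mulmxA hs_adjr trmxCK hs_braket; apply: a0.
Qed.

End CbNorm.

(* A convex function that is the sum of the smoothed seminorms
   [sqrt (k^2 + B x rho rho)] has no decreasing direction at an approximate
   minimiser.  Neither compactness nor an exact minimiser is needed because the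
   smoothing bounds the second-order term, by AM-GM. *)
Lemma approx_minimiser (R : realType) (X : finType) (T : Type) (t0 : T)
    (B : X -> T -> T -> R) (c k : R) :
  0 < k -> 0 <= c ->
  (forall x r, 0 <= B x r r) ->
  (forall x r r', B x r r - 2 * B x r r' + B x r' r' <= c) ->
  (forall r r' t, 0 <= t <= 1 -> exists rt, forall x,
     B x rt rt = (1 - t) ^+ 2 * B x r r + 2 * t * (1 - t) * B x r r' +
                 t ^+ 2 * B x r' r') ->
  exists r, forall r',
    \sum_x B x r r / Num.sqrt (k ^+ 2 + B x r r) <=
    \sum_x B x r r' / Num.sqrt (k ^+ 2 + B x r r) + k.
Proof.
move=> k0 c0 B0 Bc mix.
pose s x r := Num.sqrt (k ^+ 2 + B x r r).
have sE x r : s x r ^+ 2 = k ^+ 2 + B x r r.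
  by rewrite sqr_sqrtr // addr_ge0 // exprn_ge0 // ltW.
have sk x r : k <= s x r.
  by rewrite -[k]gtr0_norm // -sqrtr_sqr ler_wsqrtr // lerDl.
have s0 x r : 0 < s x r by apply: lt_le_trans k0 (sk x r).
pose g r := \sum_x s x r.
have g0 r : 0 <= g r by apply: sumr_ge0 => x _; apply/ltW.
pose K := \sum_(x : X) c / (2 * k).
have K0 : 0 <= K by apply: sumr_ge0 => x _; rewrite divr_ge0 // mulr_ge0 // ltW.
(* Chosen so that t (1 + K) <= k. After division by t, K stems from the second-order terms and 1
   from the t^2 by which [r] may miss the infimum. *)
pose t := Num.min 1 (k / (1 + K)).
have K1 : 0 < 1 + K by rewrite ltr_wpDr.
have t0' : 0 < t by rewrite lt_min ltr01 divr_gt0.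
have t1 : t <= 1 by rewrite ge_min lexx.
have tk : t * (1 + K) <= k.
  by rewrite -ler_pdivlMr // ge_min lexx orbT.
have ginf : has_inf (range g).
  by split; [exists (g t0), t0 | exists 0 => _ [r _ <-]].
have [_ [r _ <-] rmin] := inf_adherent (exprn_gt0 2 t0') ginf.
exists r => r'; rewrite -/(s _ r).
have [|rt rtE] := mix r r' t; first by rewrite ltW.
have step x : s x rt <= s x r + t * (B x r r' / s x r - B x r r / s x r)
    + t ^+ 2 * (c / (2 * k)).
  have sx := s0 x r; have sx0 : s x r != 0 by rewrite gt_eqF.
  (* The tangent of the concave square root at [s x r ^+ 2]; its right-hand side is a polynomial in
     t, because [B] is quadratic along the mixture. *)
  have amgm : s x rt <= s x r + (B x rt rt - B x r r) / (2 * s x r).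
    rewrite -subr_ge0.
    have -> : s x r + (B x rt rt - B x r r) / (2 * s x r) - s x rt =
              (s x rt - s x r) ^+ 2 / (2 * s x r).
      have -> : B x rt rt - B x r r = s x rt ^+ 2 - s x r ^+ 2.
        by rewrite !sE; ring.
      by field.
    by rewrite divr_ge0 ?sqr_ge0 // mulr_ge0 // ltW.
  apply: (le_trans amgm).
  have -> : (B x rt rt - B x r r) / (2 * s x r) =
     t * (B x r r' / s x r - B x r r / s x r) +
     t ^+ 2 * ((B x r r - 2 * B x r r' + B x r' r') / (2 * s x r)).
    by rewrite rtE; field.
  rewrite addrA lerD2l ler_wpM2l ?exprn_ge0 ?(ltW t0') //.
  apply: (@le_trans _ _ (c / (2 * s x r))).
    by rewrite ler_wpM2r ?Bc // invr_ge0 mulr_ge0 // ltW.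
  by rewrite ler_wpM2l // lef_pV2 ?posrE ?mulr_gt0 // ler_wpM2l.
have : g rt <= g r + t * (\sum_x B x r r' / s x r - \sum_x B x r r / s x r)
    + t ^+ 2 * K.
  rewrite /g /K -sumrB !mulr_sumr -!big_split.
  by apply: ler_sum => x _; apply: step.
have : inf (range g) <= g rt by apply: ge_inf; [exact: ginf.2 | exists rt].
set S := _ - _ => h1 h2.
have h3 : 0 <= t * (t * (1 + K) + S) by nra.
rewrite pmulr_rge0 // in h3.
by rewrite -lerBlDl; move: h3 tk; rewrite /S; lra.
Qed.

(** * Splitting an instrument along its readout *)

Section Refinement.
Variable R : realType.
Local Notation C := R[i].
Local Notation Re := complex.Re.

Lemma nsq_onb d n (X : finType) (phi : X -> 'cV[C]_d) (U : 'M[C]_(d, n)) :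
  orthonormal_basis phi -> \sum_x nsq ((phi x)^t* *m U) = nsq U.
Proof.
move=> onb; under eq_bigr do rewrite nsq_mulmx trmxCK.
by rewrite /rip -Re_sum -hs_sumr -mulmx_suml (onb_resolution onb) mul1mx.
Qed.

Lemma onb_nsq1 d (X : finType) (phi : X -> 'cV[C]_d) x :
  orthonormal_basis phi -> nsq (phi x) = 1.
Proof. by move=> [ortho _]; rewrite /nsq /rip hs_braket ortho eqxx. Qed.

(** A unital map from the zero algebra into a nonzero one would violate the isometry identity on a
    unit vector, which would read 0 = 1. This supplies a basis vector of the instrument's output,
    needed later to complete a channel. *)
Lemma channel_nontrivial S S' (T : obs R S -> obs R S') (y' : values S') :
  channel T -> (0 < hdim S')%N -> exists (y0 : values S) (i0 : 'I_(hdim S)), True.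
Proof.
move=> chT; case: S' T y' chT => Y' [//|h] T y' chT _.
have [J [pt [A kT]]] := channel_kraus chT; have [_ T1 _] := chT.
have := kraus_unital_nsq kT T1 y' (delta_mx ord0 ord0 : 'cV_h.+1).
case: (pickP (fun j : J => true)) => [j _|J0]; last first.
  rewrite big_pred0 => [|j]; last exact: J0.
  rewrite /nsq /rip hs_braket -[X in braket _ X]mul1mx braket_delta mxE eqxx.
  by move/eqP; rewrite eq_sym oner_eq0.
case: (posnP (hdim S)) => [b0|b0].
  rewrite big1 => [|k _]; last first.
    rewrite /nsq /rip hsE big1 // => i _; suff : False by [].
    by case: i => m; rewrite b0.
  rewrite /nsq /rip hs_braket -[X in braket _ X]mul1mx braket_delta mxE eqxx.
  by move/eqP; rewrite eq_sym oner_eq0.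
by exists (pt j), (Ordinal b0).
Qed.

Variables (d b : nat) (X Y : finType).
Variable E : obs R (hybrid Y b) -> obs R (quantum d).
Variable r : obs R (classical X) -> obs R (classical Y).

Definition indic (x : X) : obs R (classical X) := unit_obs R (S := classical X) x 0 0.

Lemma indic_sum (f : obs R (classical X)) : f = \sum_x f x 0 0 *: indic x.
Proof.
apply/ffunP => x; rewrite sum_ffunE (bigD1 x) //= big1 => [|x' xx'].
  rewrite addr0 !ffunE eqxx; apply/matrixP => i j.
  by rewrite !ord1 !mxE !eqxx mulr1.
by rewrite !ffunE eq_sym (negbTE xx') scaler0.
Qed.

(* Kraus operators of the instruments [a |-> E (r (1_x) (x) 1 * a)], which add
   up to [E]. *)
Lemma refined_kraus : channel E -> channel r ->
  exists (J : finType) (pt : J -> Y) (A : X -> J -> 'M[C]_(b, d)),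
    (forall a, E a tt = \sum_x \sum_j (A x j)^t* *m a (pt j) *m A x j) /\
    (forall x, E (tensor1 b (r (indic x))) tt =
               \sum_j (A x j)^t* *m A x j).
Proof.
move=> chE chr; have [J [pt [V kE]]] := channel_kraus chE.
have [lr r1 _] := chr.
pose p x y := Re (r (indic x) y 0 0).
have rpos x y : 0 <= r (indic x) y 0 0.
  have /(_ y (delta_mx 0 0)) : obs_pos (r (indic x)).
    apply: channel_obs_pos => // x' v; rewrite ffunE.
    case: eqP => _; last by rewrite mul0mx -hs_braket /hs mulmx0 raddf0.
    have -> : delta_mx 0 0 = 1%:M :> 'M[C]_1.
      by apply/matrixP => i j; rewrite !ord1 !mxE eqxx.
    by rewrite mul1mx -hs_braket hs_ge0.
  by rewrite braket_delta.
have p0 x y : 0 <= p x y by apply: Re_ge0.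
have pE x y : (p x y)%:C = r (indic x) y 0 0 by rewrite ReK.
have p1 y : \sum_x (p x y)%:C = 1.
  transitivity (r (obs1 R (classical X)) y 0 0); last first.
    by rewrite r1 ffunE mxE eqxx.
  rewrite (indic_sum (obs1 R (classical X))) linear_sumZ // sum_ffunE summxE.
  by apply: eq_bigr => x _; rewrite !ffunE !mxE eqxx mul1r pE.
(* The post-processing is a stochastic matrix p(x|y). Each Kraus operator is split with the weights
   p(x | pt j), under a square root since it enters quadratically. *)
pose A x j := (Num.sqrt (p x (pt j)))%:C *: V tt j.
have AE x j (M : 'M_b) : (A x j)^t* *m M *m A x j =
    (p x (pt j))%:C *: ((V tt j)^t* *m M *m V tt j).
  rewrite adjZ conj_real -!scalemxAl -scalemxAr scalerA.
  by rewrite -rmorphM -expr2 sqr_sqrtr.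
exists J, pt, A; split=> [a|x].
  rewrite kE exchange_big; apply: eq_bigr => j _ /=.
  under eq_bigr do rewrite AE.
  by rewrite -scaler_suml p1 scale1r.
rewrite kE; apply: eq_bigr => j _; rewrite ffunE.
rewrite -[X in _ = X *m _]mulmx1 AE -pE.
by rewrite mul_mx_scalar -scalemxAl mulmx1.
Qed.

End Refinement.

(** * Mixed states and a lower bound on the fidelity *)

Section Fidelity.
Variable R : realType.
Local Notation C := R[i].
Local Notation Re := complex.Re.

(* Purifications of arbitrary dimension make mixtures immediate. *)
Definition density d (rho : 'M[C]_d) :=
  exists n (psi : 'M[C]_(d, n)), nsq psi = 1 /\ rho = psi *m psi^t*.

Lemma density_mix d (rho rho' : 'M[C]_d) t : 0 <= t <= 1 ->
  density rho -> density rho' ->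
  density ((1 - t)%:C *: rho + t%:C *: rho').
Proof.
move=> /andP[t0 t1] [n [psi [psi1 ->]]] [n' [psi' [psi'1 ->]]].
exists (n + n')%N,
  (row_mx ((Num.sqrt (1 - t))%:C *: psi) ((Num.sqrt t)%:C *: psi')).
have adj_row p q (U : 'M[C]_(d, p)) (V : 'M[C]_(d, q)) :
    (row_mx U V)^t* = col_mx (U^t*) (V^t*).
  by rewrite tr_row_mx map_col_mx.
have sq s (n'' : nat) (U : 'M[C]_(d, n'')) : 0 <= s ->
    ((Num.sqrt s)%:C *: U) *m ((Num.sqrt s)%:C *: U)^t* = s%:C *: (U *m U^t*).
  move=> s0; rewrite adjZ conj_real -scalemxAl -scalemxAr scalerA -rmorphM.
  by rewrite -expr2 sqr_sqrtr.
have rowE : row_mx ((Num.sqrt (1 - t))%:C *: psi) ((Num.sqrt t)%:C *: psi') *m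
   (row_mx ((Num.sqrt (1 - t))%:C *: psi) ((Num.sqrt t)%:C *: psi'))^t* =
   (1 - t)%:C *: (psi *m psi^t*) + t%:C *: (psi' *m psi'^t*).
  by rewrite adj_row mul_row_col !sq // subr_ge0.
split=> //; rewrite /nsq /rip /hs mxtrace_mulC rowE mxtraceD !mxtraceZ ReD.
rewrite !Re_realM !(mxtrace_mulC _ (_^t*)) -!/(hs _ _) -!/(rip _ _) -!/(nsq _).
by rewrite psi1 psi'1; ring.
Qed.

(** As tau tau^* / q is the projection onto tau, U is self-adjoint with square 1. *)
Lemma reflection_unitary n (tau : 'cV[C]_n) (q : R) : nsq tau = q -> q != 0 ->
  let U := (2 / q)%:C *: (tau *m tau^t*) - 1%:M in U *m U^t* = 1%:M.
Proof.
move=> tq q0; set e := tau *m tau^t*.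
have ee : e *m e = q%:C *: e.
  rewrite /e -mulmxA (mulmxA (tau^t*)).
  have -> : tau^t* *m tau = q%:C%:M.
    by rewrite [LHS]mx11_scalar -/(braket tau tau) -hs_braket hs_nsq tq.
  by rewrite mul_scalar_mx -scalemxAr.
have ea : e^t* = e by rewrite /e adjM trmxCK.
move: e ee ea => e ee ea /=.
rewrite adjD adjN adj1 adjZ conj_real ea.
rewrite mulmxBl mul1mx mulmxBr mulmx1 -scalemxAl -scalemxAr ee !scalerA.
rewrite -!rmorphM opprB.
have -> : 2 / q * (2 / q) * q = 2 / q + 2 / q by field.
by rewrite rmorphD scalerDl addrK addrC subrK.
Qed.

Lemma hs_outer d n (U : 'M[C]_(d, n)) (D : 'M_d) (t : 'cV_n) :
  hs U (D *m U *m (t *m t^t*)) = hs (U *m t) (D *m (U *m t)).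
Proof.
rewrite /hs adjM -(mulmxA (t^t*)) [RHS]mxtrace_mulC.
by rewrite !mulmxA.
Qed.

Variables (d b : nat) (X Y : finType) (phi : X -> 'cV[C]_d).
Hypothesis onb : orthonormal_basis phi.
Variable F : obs R (classical X) -> obs R (quantum d).
Hypothesis chF : channel F.
Let Lam x : 'M[C]_d := F (indic R x) tt.

Lemma observable_sum f : F f tt = \sum_x f x 0 0 *: Lam x.
Proof.
have [lF _ _] := chF.
rewrite {1}(indic_sum f) linear_sumZ // sum_ffunE.
by apply: eq_bigr => x _; rewrite ffunE.
Qed.

Lemma Lam_sum : \sum_x Lam x = 1%:M.
Proof.
have [_ F1 _] := chF; have := observable_sum (obs1 R (classical X)).
rewrite F1 ffunE => ->; apply: eq_bigr => x _.
by rewrite ffunE mxE eqxx scale1r.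
Qed.

(** The entries [c x j i] are transposed because the amplifying factor indexes the columns of psi,
    on which operators act from the right. *)
Lemma test_aform n (c : X -> 'M[C]_n) (psi : 'M[C]_(d, n)) :
  aform (map_mx (fun f => ideal_measurement phi f - F f)
    (\matrix_(i, j) [ffun x => (c x j i)%:M])) tt psi psi =
  \sum_x hs psi ((phi x *m (phi x)^t* - Lam x) *m psi *m c x).
Proof.
rewrite /aform; under [RHS]eq_bigr => x _ do rewrite hs_col.
rewrite [RHS]exchange_big /=; apply: eq_bigr => i _.
under [RHS]eq_bigr => x _ do rewrite -hs_braket.
rewrite -hs_sumr.
have -> : \sum_x col i ((phi x *m (phi x)^t* - Lam x) *m psi *m c x) =
   \sum_j (map_mx (fun f => ideal_measurement phi f - F f)
    (\matrix_(i, j) [ffun x => (c x j i)%:M]) i j) tt *m col j psi.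
  under [RHS]eq_bigr => j _.
    rewrite !mxE !ffunE observable_sum -sumrB.
    under eq_bigr do rewrite !ffunE !mxE eqxx mulr1n -scalerBr.
    rewrite mulmx_suml; over.
  rewrite [RHS]exchange_big; apply: eq_bigr => x _ /=.
  apply/matrixP => k l; rewrite summxE !mxE; apply: eq_bigr => j _.
  rewrite -scalemxAl [RHS]mxE mulrC; congr (_ * _).
  by rewrite -col_mul [RHS]mxE.
by rewrite hs_sumr; apply: eq_bigr => j _; rewrite hs_braket.
Qed.

Lemma test_bounded n (c : X -> 'M[C]_n) : (forall x, c x *m (c x)^t* = 1%:M) ->
  @amp_bounded R (classical X) n (\matrix_(i, j) [ffun x => (c x j i)%:M]) 1.
Proof.
move=> cu x V W; have -> : @aform R (classical X) n
    (\matrix_(i, j) [ffun x => (c x j i)%:M]) x V W = hs V (W *m c x).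
  rewrite /aform hs_col; apply: eq_bigr => i _.
  rewrite -!hs_braket; under eq_bigr do rewrite -hs_braket.
  rewrite -hs_sumr; congr (hs _ _); apply/matrixP => k l.
  rewrite summxE !mxE; apply: eq_bigr => j _.
  by rewrite [(\matrix_(_, _) _) i j]mxE ffunE mul_scalar_mx !mxE mulrC.
have Wc : nsq (W *m c x) = nsq W.
  by rewrite -nsq_adj adjM nsq_mulmx trmxCK cu mul1mx -/(nsq _) nsq_adj.
have := nsq_ge0 (V - W *m c x); rewrite nsqB Wc -/(rip _ _); lra.
Qed.

(* A Fuchs-van de Graaf inequality.  As the states [rho^(1/2) phi x] are pure,
   the test that projects onto [psi^* phi x] for those [x] where this helps, and
   rejects the other [x], is enough.  The contraction fed to the amplified map is
   twice the test minus 1. *)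
Lemma fidelity_ge (eps : R) (rho : 'M[C]_d) :
  cb_le (fun f => ideal_measurement phi f - F f) (2 * eps) -> density rho ->
  (forall x, 0 <= rip (rho *m phi x) (Lam x *m (rho *m phi x))) ->
  1 - eps <= \sum_x Num.sqrt (rip (rho *m phi x) (Lam x *m (rho *m phi x))).
Proof.
move=> cbF [n [psi [psi1 rhoE]]] B0.
pose tau x := psi^t* *m phi x; pose q x := nsq (tau x).
(* Equals <tau_x, psi^* Lam_x psi tau_x>: the squared fidelity of the unnormalised conditional
   states tau_x tau_x^* of the ideal measurement and psi^* Lam_x psi of the readout. *)
pose B x := rip (rho *m phi x) (Lam x *m (rho *m phi x)).
have q0 x : 0 <= q x by apply: nsq_ge0.
have q1 : \sum_x q x = 1.
  rewrite -psi1 -(nsq_onb psi onb); apply: eq_bigr => x _.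
  by rewrite -nsq_adj adjM trmxCK.
pose sel x := B x < q x ^+ 2.
have selq x : sel x -> q x != 0.
  by apply: contraL => /eqP; rewrite /sel => ->; rewrite expr0n -leNgt; apply: B0.
pose c x : 'M[C]_n :=
  (if sel x then (2 / q x)%:C *: (tau x *m (tau x)^t*) else 0) - 1%:M.
have cu x : c x *m (c x)^t* = 1%:M.
  rewrite /c; case: ifP => [sx|_]; first exact: reflection_unitary (selq _ sx).
  by rewrite sub0r adjN adj1 mulmxN mulNmx opprK mulmx1.
have := cbF n _ (test_bounded cu) tt psi psi.
rewrite test_aform.
have -> : \sum_x hs psi ((phi x *m (phi x)^t* - Lam x) *m psi *m c x) =
   \sum_x (if sel x then (2 / q x)%:C *
       hs (rho *m phi x) ((phi x *m (phi x)^t* - Lam x) *m (rho *m phi x)) else 0).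
  (* The summand -1 of each [c x] contributes nothing in total, since both families of effects add
     up to 1. *)
  have D0 : \sum_x hs psi ((phi x *m (phi x)^t* - Lam x) *m psi) = 0.
    rewrite -hs_sumr -mulmx_suml sumrB Lam_sum (onb_resolution onb) subrr.
    by rewrite mul0mx /hs mulmx0 raddf0.
  rewrite -[RHS]subr0 -[X in _ = _ - X]D0 -sumrB; apply: eq_bigr => x _.
  rewrite /c mulmxBr mulmx1 hsDr hsNr; congr (_ - _).
  case: ifP => _; last by rewrite mulmx0 /hs mulmx0 raddf0.
  rewrite -scalemxAr hsZr; congr (_ * _).
  by rewrite hs_outer rhoE -mulmxA.
have braE x : rip (rho *m phi x) ((phi x *m (phi x)^t* - Lam x) *m (rho *m phi x))
    = q x ^+ 2 - B x.
  rewrite mulmxBl ripDr ripNr; congr (_ - _).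
  rewrite /rip -mulmxA hs_adjr -/(rip _ _) -/(nsq _).
  have -> : (phi x)^t* *m (rho *m phi x) = (q x)%:C%:M.
    have -> : (q x)%:C%:M = (tau x)^t* *m tau x.
      by rewrite [RHS]mx11_scalar -/(braket _ _) -hs_braket hs_nsq.
    by rewrite rhoE /tau adjM trmxCK !mulmxA.
  by rewrite -scalemx1 nsqZ /nsq /rip hsE !big_ord1 !mxE rmorph1 mulr1 /= mulr1.
rewrite Re_sum psi1 => main.
have {}main : \sum_x (if sel x then q x - B x / q x else 0) <= eps.
  have : \sum_x (if sel x then q x - B x / q x else 0) = 2^-1 * \sum_x Re
     (if sel x then (2 / q x)%:C *
       hs (rho *m phi x) ((phi x *m (phi x)^t* - Lam x) *m (rho *m phi x)) else 0).
    rewrite mulr_sumr; apply: eq_bigr => x _; case: ifP => [sx|_]; last first.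
      by rewrite mulr0.
    rewrite Re_realM -/(rip _ _) braE; have := selq _ sx.
    by move=> qx; field.
  by move=> ->; move: main; lra.
(* With f = sqrt (B x): for selected x, f <= q x and thus B x / q x <= f; for the others, q x - f <=
   0. *)
suff : \sum_x (q x - Num.sqrt (B x)) <= eps by rewrite sumrB q1 /B; lra.
apply: le_trans main; apply: ler_sum => x _.
set f := Num.sqrt (B x); have f0 : 0 <= f by apply: sqrtr_ge0.
have f2 : B x = f ^+ 2 by rewrite sqr_sqrtr // B0.
case: ifP => [sx|/negbT nsx].
  have qx : 0 < q x by rewrite lt_def (selq _ sx) q0.
  have fq : f <= q x.
    rewrite -(ler_pXn2r (n := 2)) ?nnegrE ?f0 ?q0 // -f2; exact: ltW.
  by rewrite lerD2l lerN2 ler_pdivrMr // f2 expr2 ler_wpM2l.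
rewrite subr_le0 -(ler_pXn2r (n := 2)) ?nnegrE ?f0 ?q0 // -f2.
by rewrite /sel -leNgt in nsx.
Qed.

End Fidelity.

(** * Approximate factorisation through the ideal measurement *)

Section Factorisation.
Variable R : realType.
Local Notation C := R[i].
Local Notation Re := complex.Re.
Variables (d b : nat) (X Y : finType) (phi : X -> 'cV[C]_d).
Hypothesis onb : orthonormal_basis phi.
Variables (E : obs R (hybrid Y b) -> obs R (quantum d)).
Variable r : obs R (classical X) -> obs R (classical Y).
Hypotheses (chE : channel E) (chr : channel r).
Variables (J : finType) (pt : J -> Y) (A : X -> J -> 'M[C]_(b, d)).
Hypothesis E_A : forall a, E a tt = \sum_x \sum_j (A x j)^t* *m a (pt j) *m A x j.
Hypothesis Lam_A : forall x,
  E (tensor1 b (r (indic R x))) tt = \sum_j (A x j)^t* *m A x j.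

(* [<U, Lam x W>], where [Lam x] is the x-th effect of the readout. *)
Definition wip x n (U W : 'M[C]_(d, n)) : R :=
  \sum_j rip (A x j *m U) (A x j *m W).

Lemma wip_Lam x n (U W : 'M[C]_(d, n)) :
  rip U (E (tensor1 b (r (indic R x))) tt *m W) = wip x U W.
Proof.
rewrite Lam_A mulmx_suml /rip hs_sumr Re_sum; apply: eq_bigr => j _.
by rewrite -mulmxA hs_adjr trmxCK.
Qed.

Lemma wip_ge0 x n (U : 'M[C]_(d, n)) : 0 <= wip x U U.
Proof. by apply: sumr_ge0 => j _; apply: nsq_ge0. Qed.

Lemma wip_sum n (U : 'M[C]_(d, n)) : \sum_x wip x U U = nsq U.
Proof.
have [_ E1 _] := chE; have := E_A (obs1 R (hybrid Y b)).
rewrite E1 ffunE => A1.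
rewrite /nsq -[X in rip _ X]mul1mx A1 mulmx_suml /rip hs_sumr Re_sum.
apply: eq_bigr => x _; rewrite mulmx_suml hs_sumr Re_sum.
apply: eq_bigr => j _; rewrite ffunE mulmx1 -mulmxA.
by rewrite hs_adjr trmxCK.
Qed.

Lemma wip_le x n (U : 'M[C]_(d, n)) : wip x U U <= nsq U.
Proof.
rewrite -(wip_sum U) (bigD1 x) //= lerDl.
by apply: sumr_ge0 => x' _; apply: wip_ge0.
Qed.

Lemma wipC x n (U W : 'M[C]_(d, n)) : wip x U W = wip x W U.
Proof. by apply: eq_bigr => j _; rewrite ripC. Qed.

Lemma wipDl x n (U V W : 'M[C]_(d, n)) : wip x (U + V) W = wip x U W + wip x V W.
Proof. by rewrite -big_split; apply: eq_bigr => j _; rewrite mulmxDr ripDl. Qed.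

Lemma wipZl x n t (U W : 'M[C]_(d, n)) : wip x (t%:C *: U) W = t * wip x U W.
Proof.
by rewrite mulr_sumr; apply: eq_bigr => j _; rewrite -scalemxAr ripZl.
Qed.

Lemma wipDr x n (U V W : 'M[C]_(d, n)) : wip x W (U + V) = wip x W U + wip x W V.
Proof. by rewrite wipC wipDl !(wipC x W). Qed.

Lemma wipZr x n t (U W : 'M[C]_(d, n)) : wip x W (t%:C *: U) = t * wip x W U.
Proof. by rewrite wipC wipZl (wipC x W). Qed.

Lemma density_nsq_le rho x : density rho -> nsq (rho *m phi x) <= 1.
Proof.
move=> [n [psi [psi1 ->]]]; rewrite -mulmxA.
apply: (le_trans (nsq_mulcV_le _ _)); rewrite psi1 mul1r.
apply: (le_trans (nsq_mulcV_le _ _)).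
by rewrite nsq_adj psi1 mul1r (onb_nsq1 x onb).
Qed.

Lemma density_exists : (0 < d)%N -> exists rho : 'M[C]_d, density rho.
Proof.
case: d => // d' _; exists ((delta_mx 0 0 : 'cV_d'.+1) *m (delta_mx 0 0)^t*), 1%N.
exists (delta_mx 0 0); split=> //.
by rewrite /nsq /rip hs_braket -[X in braket _ X]mul1mx braket_delta mxE eqxx.
Qed.

(** First-order optimality of the smoothed fidelity in the direction U U^*, for u_x = V_x rho phi_x
    / s x. Smoothing costs k for each x and approximate minimality one more k. Unit U suffices by
    homogeneity. *)
Lemma overlap eps k : (0 < d)%N -> 0 < k ->
  cb_le (fun f => ideal_measurement phi f - E (tensor1 b (r f))) (2 * eps) ->
  exists (rho : 'M[C]_d) (s : X -> R),
    [/\ forall x, 0 < s x,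
        forall x, wip x (rho *m phi x) (rho *m phi x) <= s x ^+ 2 &
        forall n (U : 'M[C]_(d, n)),
          (1 - eps - (#|X|%:R + 1) * k) * nsq U <=
          \sum_x (s x)^-1 * wip x (rho *m phi x) (U *m (U^t* *m phi x))].
Proof.
move=> d0 k0 cbE.
have chF : channel (fun f => E (tensor1 b (r f))).
  exact: channel_comp (channel_comp chr (tensor1_channel R Y b)) chE.
pose T := {rho : 'M[C]_d | density rho}.
have [rho0 drho0] := density_exists d0.
pose v x (t : T) := sval t *m phi x.
pose B x (t t' : T) := wip x (v x t) (v x t').
have B0 x t : 0 <= B x t t by apply: wip_ge0.
(* Parallelogram bound: |v - v'|^2 <= 2 (|v|^2 + |v'|^2), where both squares are at most 1. *)
have Bc x t t' : B x t t - 2 * B x t t' + B x t' t' <= 4.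
  apply: (@le_trans _ _ (2 * (B x t t + B x t' t'))).
    rewrite -subr_ge0.
    have -> : 2 * (B x t t + B x t' t') - (B x t t - 2 * B x t t' + B x t' t') =
        wip x (v x t + v x t') (v x t + v x t').
      rewrite wipDl !wipDr (wipC x (v x t') (v x t)) /B.
      move: (wip _ _ _) (wip _ _ _) (wip _ _ _) => p q p'; ring.
    exact: wip_ge0.
  have Ble t'' : B x t'' t'' <= 1.
    by apply: (le_trans (wip_le _ _)); apply: density_nsq_le (svalP t'').
  move: (Ble t) (Ble t'); move: (B x t t) (B x t' t') => p q; lra.
have Bmix t t' s : 0 <= s <= 1 -> exists ts, forall x, B x ts ts =
    (1 - s) ^+ 2 * B x t t + 2 * s * (1 - s) * B x t t' + s ^+ 2 * B x t' t'.
  move=> s01; exists (exist _ _ (density_mix s01 (svalP t) (svalP t'))) => x.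
  rewrite /B /v /= mulmxDl -!scalemxAl wipDl !wipDr !wipZl !wipZr.
  rewrite (wipC x (sval t' *m phi x) (sval t *m phi x)).
  move: (wip _ _ _) (wip _ _ _) (wip _ _ _) => p q p'; ring.
have [t tmin] := approx_minimiser (exist _ rho0 drho0 : T) k0 (ler0n R 4) B0 Bc Bmix.
pose s x := Num.sqrt (k ^+ 2 + B x t t).
have sE x : s x ^+ 2 = k ^+ 2 + B x t t.
  by rewrite sqr_sqrtr // addr_ge0 // exprn_ge0 // ltW.
have sk x : k <= s x.
  by rewrite -[k]gtr0_norm // -sqrtr_sqr ler_wsqrtr // lerDl.
have s0 x : 0 < s x by apply: lt_le_trans k0 (sk x).
exists (sval t), s; split=> // [x|].
  by rewrite sE lerDr exprn_ge0 // ltW.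
have fid : 1 - eps <= \sum_x Num.sqrt (B x t t).
  have := fidelity_ge onb chF cbE (svalP t).
  under eq_bigr do rewrite wip_Lam.
  by apply=> x; rewrite wip_Lam; apply: B0.
(* With f = sqrt (B x t t) <= s: B x t t = s^2 - k^2 >= (s - k) s >= (f - k) s when k <= s. *)
have low : 1 - eps - #|X|%:R * k <= \sum_x B x t t / s x.
  apply: (@le_trans _ _ (\sum_x (Num.sqrt (B x t t) - k))).
    by rewrite sumrB sumr_const -[k *+ _]mulr_natl lerD2r.
  apply: ler_sum => x _; rewrite ler_pdivlMr //.
  have : Num.sqrt (B x t t) <= s x by rewrite ler_wsqrtr // lerDr exprn_ge0 // ltW.
  have -> : B x t t = s x ^+ 2 - k ^+ 2 by rewrite sE; ring.
  move=> h; apply: (@le_trans _ _ ((s x - k) * s x)).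
    by rewrite ler_pM2r // lerD2r.
  by move: (s x) (sk x) k0 => u; move: {+}k => l lu l0; nra.
have main1 n (U : 'M[C]_(d, n)) : nsq U = 1 -> 1 - eps - (#|X|%:R + 1) * k <=
    \sum_x (s x)^-1 * wip x (v x t) (U *m (U^t* *m phi x)).
  move=> U1; have dU : density (U *m U^t*) by exists n, U.
  have e x : B x t (exist _ _ dU) / s x =
      (s x)^-1 * wip x (v x t) (U *m (U^t* *m phi x)).
    rewrite [LHS]mulrC; congr (_ * wip _ _ _); exact/esym/mulmxA.
  have := tmin (exist _ _ dU); rewrite [X in _ <= X + _](eq_bigr _ (fun x _ => e x)).
  by move: low; rewrite /s mulrDl mul1r; lra.
move=> n U; have [U0|U0] := eqVneq (nsq U) 0.
  rewrite U0 mulr0 (nsq_eq0 U0) big1 // => x _.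
  rewrite mul0mx /wip big1 ?mulr0 // => j _.
  by rewrite mulmx0 /rip /hs mulmx0 raddf0.
have Ugt0 : 0 < nsq U by rewrite lt_def U0 nsq_ge0.
pose w := (Num.sqrt (nsq U))^-1.
have w2 : w ^+ 2 * nsq U = 1.
  by rewrite -{1}(sqr_sqrtr (nsq_ge0 U)) -exprMn mulVf ?expr1n // sqrtr_eq0 -ltNge.
have := main1 n (w%:C *: U); rewrite nsqZ w2 => /(_ erefl) h.
have wE : w ^+ 2 = (nsq U)^-1 by apply: (mulIf U0); rewrite w2 mulVf.
have e x : (s x)^-1 * wip x (v x t) ((w%:C *: U) *m ((w%:C *: U)^t* *m phi x)) =
    w ^+ 2 * ((s x)^-1 * wip x (v x t) (U *m (U^t* *m phi x))).
  rewrite adjZ conj_real -(scalemxAl _ (U^t*)) -(scalemxAl _ U) -scalemxAr scalerA.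
  by rewrite -rmorphM wipZr expr2 mulrCA.
rewrite (eq_bigr _ (fun x _ => e x)) -mulr_sumr wE [leRHS]mulrC in h.
by rewrite -ler_pdivlMr.
Qed.

(* With V = (A x)_x and W = (A x K x)_x, completed by [g x] to an isometry,
   V^* a V - W^* a W = (V - W)^* a V + W^* a (V - W), and [overlap] bounds
   V - W.  The second term of [B] only serves to make [M] unital. *)
Lemma factorisation eps k (y0 : Y) (i0 : 'I_b) : (0 < d)%N -> 0 < k -> 0 <= eps ->
  cb_le (fun f => ideal_measurement phi f - E (tensor1 b (r f))) (2 * eps) ->
  exists M : obs R (hybrid Y b) -> obs R (classical X), channel M /\
    cb_le (fun a => E a - ideal_measurement phi (M a))
      (2 * Num.sqrt (2 * (eps + (#|X|%:R + 1) * k))).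
Proof.
move=> d0 k0 eps0 cbE; have [rho [s [s0 s2 ov]]] := overlap d0 k0 cbE.
set eta := Num.sqrt _.
(* Since k > 0, eta is positive even for eps = 0 and can serve as an AM-GM weight. *)
have eta_arg : 0 < 2 * (eps + (#|X|%:R + 1) * k).
  by rewrite mulr_gt0 // ltr_wpDl // mulr_gt0 // ltr_wpDl.
have eta0 : 0 < eta by rewrite sqrtr_gt0.
have eta2 : eta ^+ 2 = 2 * (eps + (#|X|%:R + 1) * k) by rewrite sqr_sqrtr // ltW.
(* The squared norm of u_x. Smoothing makes it at most 1, and the deficit becomes the weight of the
   additional Kraus operator. *)
pose nu x := (s x)^-1 ^+ 2 * wip x (rho *m phi x) (rho *m phi x).
have nu1 x : nu x <= 1.
  by rewrite /nu exprVn mulrC ler_pdivrMr ?exprn_gt0 // mul1r.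
pose pt' (o : J + unit) := if o is inl j then pt j else y0.
pose B x (o : J + unit) : 'M[C]_(b, 1) :=
  if o is inl j then ((s x)^-1)%:C *: (A x j *m (rho *m phi x))
  else (Num.sqrt (1 - nu x))%:C *: delta_mx i0 0.
pose M (a : obs R (hybrid Y b)) : obs R (classical X) :=
  [ffun x => \sum_o (B x o)^t* *m a (pt' o) *m B x o].
have kM : @kraus R (hybrid Y b) (classical X) M (J + unit)%type pt' B.
  by move=> a x; rewrite ffunE.
have chM : channel M.
  apply: (kraus_channel kM) => x; apply/matrixP => i j; rewrite !ord1.
  transitivity ((\sum_o nsq (B x o))%:C).
    rewrite summxE rmorph_sum; apply: eq_bigr => o _.
    by rewrite -/(braket _ _) -hs_braket hs_nsq.
  rewrite big_sumType /= (big_pred1 tt) => [|[]//].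
  rewrite nsqZ sqr_sqrtr ?subr_ge0 // (_ : nsq (delta_mx i0 0) = 1); last first.
    by rewrite /nsq /rip hs_braket -[X in braket _ X]mul1mx braket_delta mxE eqxx.
  under eq_bigr do rewrite nsqZ.
  by rewrite -mulr_sumr mulr1 addrC subrK mxE.
have sumJ (V : zmodType) (G : J + unit -> V) :
    \sum_o G o = \sum_j G (inl j) + G (inr tt).
  by rewrite big_sumType /= [X in _ + X](big_pred1 tt) => [|[]].
have sum4 (I : finType) (c e : R) (F1 F2 F3 F4 : I -> R) :
    \sum_i (c * F1 i + e * F2 i + (e * F3 i + c * F4 i)) =
    c * (\sum_i F1 i) + e * (\sum_i F2 i) +
    (e * (\sum_i F3 i) + c * (\sum_i F4 i)).
  by rewrite !mulr_sumr -!big_split.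
have regroup (p q u v u' q' : R) : q + v = q' -> u = u' ->
    p + q - 2 * u + v = p + q' - 2 * u' by move=> <- ->; ring.
have collect (e c p q v w gU gW : R) : 0 <= c * gU ->
    c * p + e * w + (e * q + c * v) + (e * gU + c * gW) <=
    c * (p + gU) + e * w + (e * (q + gU) + c * (v + gW)) by lra.
exists M; split=> // n a a1 y U W; case: y.
have kE : @kraus R (hybrid Y b) (quantum d) E (X * J)%type (fun p => pt p.2)
    (fun _ p => A p.1 p.2).
  by move=> f []; rewrite E_A pair_big.
rewrite map_mxB_fun aformD aformN (kraus_aform kE).
have -> : map_mx (fun f => ideal_measurement phi (M f)) a =
    map_mx (ideal_measurement phi) (map_mx M a).
  by apply/matrixP => i j; rewrite !mxE.
rewrite (kraus_aform (measurement_kraus phi)) /=.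
under [X in _ - X]eq_bigr do rewrite (kraus_aform kM).
rewrite -(pair_big predT predT (fun x j =>
  aform a (pt j) (A x j *m U) (A x j *m W))) /= -sumrB.
pose K x (V : 'M[C]_(d, n)) :=
  ((s x)^-1)%:C *: (rho *m phi x *m ((phi x)^t* *m V)).
pose g x (V : 'M[C]_(d, n)) := B x (inr tt) *m ((phi x)^t* *m V).
have BK x j V : B x (inl j) *m ((phi x)^t* *m V) = A x j *m K x V.
  by rewrite /B /K -scalemxAl -scalemxAr !mulmxA.
pose D x V := \sum_j nsq (A x j *m V - A x j *m K x V) + nsq (g x V).
have BKg x V : \sum_j nsq (A x j *m K x V) + nsq (g x V) = nsq ((phi x)^t* *m V).
  have [_ M1 _] := chM; rewrite -(kraus_unital_nsq kM M1 x) sumJ.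
  apply: (congr1 (fun z => z + nsq (g x V))).
  by apply: eq_bigr => j _; rewrite BK.
(* Cyclicity of the trace moves V^* phi_x to the other side, where V V^* appears as the direction
   rho' of the optimality condition. *)
have cross x V : \sum_j rip (A x j *m V) (A x j *m K x V) =
    (s x)^-1 * wip x (rho *m phi x) (V *m (V^t* *m phi x)).
  rewrite mulr_sumr; apply: eq_bigr => j _.
  rewrite -scalemxAr ripZr ripC; congr (_ * _).
  rewrite [X in rip X _ = _]mulmxA [LHS]rip_mulr adjM trmxCK.
  by rewrite [X in _ = rip _ X]mulmxA.
(* Both dilations are isometric, so the squared distance is 2 |V|^2 minus twice the overlap. *)
have Dsum V : \sum_x D x V <= eta ^+ 2 * nsq V.
  have -> : \sum_x D x V = 2 * nsq V -
      2 * \sum_x (s x)^-1 * wip x (rho *m phi x) (V *m (V^t* *m phi x)).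
    have -> : 2 * nsq V = \sum_x (wip x V V + nsq ((phi x)^t* *m V)).
      by rewrite big_split /= wip_sum nsq_onb //; ring.
    rewrite mulr_sumr -sumrB; apply: eq_bigr => x _.
    have -> : D x V = wip x V V + \sum_j nsq (A x j *m K x V) -
        2 * \sum_j rip (A x j *m V) (A x j *m K x V) + nsq (g x V).
      rewrite /D /wip mulr_sumr -big_split -sumrB; congr (_ + _).
      by apply: eq_bigr => j _; rewrite nsqB.
    exact: regroup (BKg x V) (cross x V).
  by move: (ov n V); rewrite eta2; move: (\sum_x _) (nsq V) => S v; nra.
(* AM-GM with weight eta: each of the four sums over x is then at most eta times |U|^2 or |W|^2. *)
apply: (@le_trans _ _ (\sum_x (eta^-1 * D x U + eta * wip x W W +
    (eta * nsq ((phi x)^t* *m U) + eta^-1 * D x W)))).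
  rewrite Re_sum mulr_sumr; apply: ler_sum => x _.
  rewrite sumJ opprD addrA -sumrB ReD [leLHS]mulrDr Re_sum mulr_sumr.
  apply: (@le_trans _ _ (\sum_j (eta^-1 * nsq (A x j *m U - A x j *m K x U) +
     eta * nsq (A x j *m W) + (eta * nsq (A x j *m K x U) +
     eta^-1 * nsq (A x j *m W - A x j *m K x W))) +
     (eta * nsq (g x U) + eta^-1 * nsq (g x W)))).
    apply: lerD; first by apply: ler_sum => j _; rewrite !BK; apply: aform_diff_le.
    (* The completing component is absent from E, so only the term of the factorised channel
       remains. *)
    by rewrite -aformNl -(nsqN (g x U)); apply: aform_le'.
  have -> : \sum_j (eta^-1 * nsq (A x j *m U - A x j *m K x U) +
     eta * nsq (A x j *m W) + (eta * nsq (A x j *m K x U) +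
     eta^-1 * nsq (A x j *m W - A x j *m K x W))) =
     eta^-1 * (\sum_j nsq (A x j *m U - A x j *m K x U)) + eta * wip x W W +
     (eta * (\sum_j nsq (A x j *m K x U)) +
      eta^-1 * \sum_j nsq (A x j *m W - A x j *m K x W)).
    exact: sum4.
  rewrite -(BKg x U); apply: collect.
  by rewrite mulr_ge0 ?nsq_ge0 // invr_ge0 ltW.
have Dle V : eta^-1 * \sum_x D x V <= eta * nsq V.
  by rewrite ler_pdivrMl // mulrA -expr2.
rewrite sum4 wip_sum nsq_onb //.
have combine (e p q u w : R) : p <= e * u -> q <= e * w ->
  p + e * w + (e * u + q) <= 2 * e * (u + w) by lra.
exact: combine (Dle U) (Dle W).
Qed.

End Factorisation.

(** * The two tradeoffs *)

Section Tradeoff.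
Variable R : realType.
Local Notation C := R[i].

Lemma le_sqrt_eps (x m : R) : 0 <= m ->
  (forall e, 0 < e -> x <= Num.sqrt (m + e)) -> x <= Num.sqrt m.
Proof.
move=> m0 h; case: (leP x 0) => [x0|x0]; first by rewrite (le_trans x0) ?sqrtr_ge0.
rewrite -[x]gtr0_norm // -sqrtr_sqr ler_wsqrtr //; apply/ler_addgt0Pr => e e0.
have := h e e0; rewrite -(ler_pXn2r (n := 2)) ?nnegrE ?sqrtr_ge0 ?(ltW x0) //.
by rewrite sqr_sqrtr // addr_ge0 // ltW.
Qed.

Variables (d b : nat) (X Z Y : finType).
Variables (phi : X -> 'cV[C]_d) (theta : Z -> 'cV[C]_d).
Variable E : obs R (hybrid Y b) -> obs R (quantum d).
Hypotheses (d_gt0 : (0 < d)%N) (onb_phi : orthonormal_basis phi).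
Hypotheses (onb_theta : orthonormal_basis theta) (chE : channel E).

Let Q := ideal_measurement phi.
Let P := ideal_preparation theta.

Let chQ : channel Q := measurement_channel onb_phi.
Let chP : channel P := preparation_channel onb_theta.

Lemma readout_channel (r : obs R (classical X) -> obs R (classical Y)) :
  channel r -> channel (fun f => E (tensor1 b (r f))).
Proof.
move=> chr; exact: channel_comp (channel_comp chr (tensor1_channel R Y b)) chE.
Qed.

Lemma onb_inhabited : exists x : X, True.
Proof.
case: (pickP (fun x : X => true)) => [x _|X0]; first by exists x.
have := onb_resolution onb_phi; rewrite big_pred0 // => /matrixP.
case: d d_gt0 phi => // d' _ _ /(_ 0 0); rewrite !mxE => /eqP.
by rewrite eq_sym oner_eq0.
Qed.

Lemma instrument_inhabited : exists (y0 : Y) (i0 : 'I_b), True.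
Proof. exact: (@channel_nontrivial _ _ _ E tt). Qed.

Let errors := [set distinguishability Q (fun f => E (tensor1 b (r f)))
  | r in [set r : obs R (classical X) -> obs R (classical Y) | channel r]].

Lemma errors_has_inf : has_inf errors.
Proof.
have [x0 _] := onb_inhabited.
pose c := @const_map R (classical X) (classical Y) x0 0.
split; first by exists (distinguishability Q (fun f => E (tensor1 b (c f)))), c => //;
  apply: const_map_channel.
exists 0 => _ [r chr <-]; exact: distinguishability_ge0 chQ (readout_channel chr).
Qed.

Lemma measurement_error_ge0 : 0 <= measurement_error phi E.
Proof.
apply: lb_le_inf; first exact: errors_has_inf.1.
move=> _ [r chr <-]; exact: distinguishability_ge0 chQ (readout_channel chr).
Qed.

Lemma approx_factorisation e : 0 < e ->
  exists M : obs R (hybrid Y b) -> obs R (classical X), channel M /\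
    cb_le (fun a => E a - Q (M a))
      (2 * Num.sqrt (2 * measurement_error phi E + e)).
Proof.
(* A quarter goes to missing the infimum and a quarter to the smoothing; the factor 2 under the root
   turns them into e. *)
move=> e0; have e4 : 0 < e / 4 by rewrite divr_gt0.
have [_ [r chr <-]] := inf_adherent e4 errors_has_inf.
rewrite -/(measurement_error phi E) => rE.
set eps := distinguishability _ _ in rE.
have [y0 [i0 _]] := instrument_inhabited.
have [J [pt [A [E_A Lam_A]]]] := refined_kraus chE chr.
have eps0 : 0 <= eps := distinguishability_ge0 chQ (readout_channel chr).
have X1 : 0 < #|X|%:R + 1 :> R by rewrite ltr_wpDl.
have k0 : 0 < e / 4 / (#|X|%:R + 1) by rewrite divr_gt0.
have cbr := distinguishability_cb_le chQ (readout_channel chr).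
have [M [chM cbM]] :=
  factorisation onb_phi chE chr E_A Lam_A y0 i0 d_gt0 k0 eps0 cbr.
exists M; split=> // n a a1 y V W; apply: (le_trans (cbM n a a1 y V W)).
rewrite ler_wpM2r ?addr_ge0 ?nsq_ge0 // ler_wpM2l // ler_wsqrtr //.
rewrite [_ * (e / 4 / _)]mulrC divfK ?gt_eqF //; move: rE.
by move: (measurement_error phi E) => v; move: eps {eps0 cbr cbM} => u; lra.
Qed.

(** A correction [r] for E yields the correction [M \o r] for the ideal measurement, as P Q M r is
    close to P E r. *)
Lemma disturbance_tradeoff :
  complementarity phi theta <=
  Num.sqrt (2 * measurement_error phi E) + preparation_disturbance theta E.
Proof.
rewrite -lerBlDl; apply: lb_le_inf.
  pose r := @const_map R (quantum d) (hybrid Y b) tt (Ordinal d_gt0).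
  by exists (distinguishability P (P \o E \o r)), r => //; apply: const_map_channel.
move=> _ [r chr <-]; rewrite lerBlDr addrC -lerBlDr.
apply: le_sqrt_eps => [|e e0]; first by rewrite mulr_ge0 // measurement_error_ge0.
have [M [chM cbM]] := approx_factorisation e0.
rewrite lerBlDl.
have chPQ : channel (P \o Q \o (M \o r)).
  exact: channel_comp (channel_comp chr chM) (channel_comp chQ chP).
apply: (@le_trans _ _ (distinguishability P (P \o Q \o (M \o r)))).
  apply: ge_inf; last by exists (M \o r) => //; exact: channel_comp chr chM.
  exists 0 => _ [r' chr' <-]; apply: distinguishability_ge0 chP _.
  exact: channel_comp chr' (channel_comp chQ chP).
have chPEr : channel (P \o E \o r) := channel_comp chr (channel_comp chE chP).
apply: (distinguishability_triangle chP chPEr (sqrtr_ge0 _)).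
have [lP _ _] := chP.
apply: cb_le_ext (cb_le_comp chr (cb_le_compl chP cbM)) => a /=.
exact: linear_opB.
Qed.

(** The infimum enters the demerit with a minus sign, so approximants travel from the measurement to
    E: if [c] is constant and close to P Q, then [c \o M] is constant and close to P Q M, hence to P
    E. *)
Lemma demerit_tradeoff :
  demerit_complementarity phi theta <=
  Num.sqrt (2 * measurement_error phi E) + demerit_disturbance theta E.
Proof.
have [x0 _] := onb_inhabited.
rewrite /demerit_complementarity /demerit_disturbance addrCA lerD2l.
rewrite lerNl opprB lerBlDr addrC -lerBlDl; set inE := inf _.
apply: lb_le_inf.
  pose c := @const_map R (classical X) (classical Z) x0 0.
  by exists (distinguishability c (P \o Q)), c => //; apply: const_map_constant.
move=> _ [c [chc [s state_s cE]] <-]; rewrite lerBlDl -lerBlDr.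
apply: le_sqrt_eps => [|e e0]; first by rewrite mulr_ge0 // measurement_error_ge0.
have [M [chM cbM]] := approx_factorisation e0.
have chcM : channel (c \o M) := channel_comp chM chc.
have chPQM : channel (P \o Q \o M).
  exact: channel_comp chM (channel_comp chQ chP).
have chPQ : channel (P \o Q) := channel_comp chQ chP.
rewrite lerBlDl; apply: (@le_trans _ _ (distinguishability (c \o M) (P \o E))).
  apply: ge_inf.
    exists 0 => _ [c' [chc' _] <-]; apply: distinguishability_ge0 chc' _.
    exact: channel_comp chE chP.
  exists (c \o M) => //; split=> //; exists (s \o M) => [|a /=]; last exact: cE.
  have [lM M1 _] := chM; have [ls s1 s0] := state_s.
  split=> [t u v||a a0] /=; [by rewrite lM ls|by rewrite M1|].
  by apply: s0; apply: channel_obs_pos.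
apply: (@le_trans _ _ (distinguishability (c \o M) (P \o Q \o M) +
    Num.sqrt (2 * measurement_error phi E + e))).
  apply: (distinguishability_triangle chcM chPQM (sqrtr_ge0 _)).
  have [lP _ _] := chP; apply: cb_le_swap.
  apply: cb_le_ext (cb_le_compl chP cbM) => a /=.
  exact: linear_opB.
rewrite lerD2r; apply: distinguishability_le; first exact: distinguishability_ge0 chc chPQ.
exact: cb_le_comp chM (distinguishability_cb_le chc chPQ).
Qed.

End Tradeoff.

Theorem theorem2 (R : realType) (d b : nat) (X Z Y : finType)
    (obsX obsZ : 'M[R[i]]_d)
    (phi : X -> 'cV[R[i]]_d) (theta : Z -> 'cV[R[i]]_d)
    (E : obs R (hybrid Y b) -> obs R (quantum d)) :
  (0 < d)%N ->
  nondegenerate_observable obsX -> orthonormal_eigenbasis obsX phi ->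
  nondegenerate_observable obsZ -> orthonormal_eigenbasis obsZ theta ->
  instrument E ->
  Num.sqrt (2 * measurement_error phi E) + preparation_disturbance theta E
    >= complementarity phi theta /\
  Num.sqrt (2 * measurement_error phi E) + demerit_disturbance theta E
    >= demerit_complementarity phi theta.
Proof.
move=> d_gt0 _ [onb_phi _] _ [onb_theta _] chE.
by split; [apply: disturbance_tradeoff | apply: demerit_tradeoff].
Qed.
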